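(* Let $H$ be a Hopf algebra of finite dimension $d$ over an algebraically closed field $F$ (of arbitrary characteristic). Let $D$ be a division algebra over $F$ of degree $m$, and suppose that $H$ acts on $D$. If $\gcd(d!,m)=1$, then: (i) The center $Z$ of $D$ is $H$-stable, and $D=ZD^H$. (ii) If $H$ is semisimple and cosemisimple, then the action of $H$ on $D$ factors through an action of a cocommutative Hopf algebra.
   Context: An action of a Hopf algebra $H$ on an algebra $D$ means that $D$ is a (left) $H$-module algebra: $D$ is an $H$-module with $h\cdot(ab)=\sum (h_{(1)}\cdot a)(h_{(2)}\cdot b)$ and $h\cdot 1=\varepsilon(h)1$. The subalgebra of invariants is $D^H=\{a\in D: h\cdot a=\varepsilon(h)a \text{ for all } h\in H\}$, and $ZD^H$ denotes the subalgebra of $D$ generated by $Z$ and $D^H$ (the span of products $za$ with $z\in Z$, $a\in D^H$). A division algebra $D$ with center $Z$ has degree $m$ if it is finite dimensional over $Z$ with $[D:Z]=m^2$; here $F$ is contained in $Z$, but $D$ need not be finite dimensional over $F$. A finite dimensional Hopf algebra is cosemisimple if its dual $H^*$ is a semisimple algebra. The action of $H$ on $D$ factors through an action of a cocommutative Hopf algebra if there is a Hopf ideal $I\subset H$ with $I\cdot D=0$ such that $H/I$ is cocommutative. *)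

(* Defs.v *)
From HB Require Import structures.
From mathcomp Require Import all_boot all_algebra all_field.

Set Implicit Arguments.
Unset Strict Implicit.
Unset Printing Implicit Defensive.

Import GRing.Theory.

Local Open Scope ring_scope.

(* U (x) V is modelled by the matrices of coordinates in [vbasis {:U}]
   and [vbasis {:V}]; the pure tensor u (x) v has coefficients u_i v_j.  [tlift] and its
   lemmas below give the universal property, so nothing depends on the bases. *)
Definition tens (F : fieldType) (U V : vectType F) : Type :=
  'M[F]_(\dim {:U}, \dim {:V}).

Definition ptens (F : fieldType) (U V : vectType F) (u : U) (v : V) :
    tens U V :=
  \matrix_(i, j) (coord (vbasis {:U}) i u * coord (vbasis {:V}) j v).

Notation "u ⊗ v" := (ptens u v) (at level 40, left associativity) : ring_scope.

(* In Sweedler notation, [tlift B t] is the sum of the B t_(1) t_(2). *)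
Definition tlift (F : fieldType) (U V : vectType F) (W : lmodType F)
    (B : U -> V -> W) (t : tens U V) : W :=
  \sum_i \sum_j t i j *: B (vbasis {:U})`_i (vbasis {:V})`_j.

Definition tswap (F : fieldType) (U V : vectType F) : tens U V -> tens V U :=
  tlift (fun u v => v ⊗ u).

Definition tmul (F : fieldType) (A B : falgType F) (s t : tens A B) :
    tens A B :=
  tlift (fun a b => tlift (fun c d => (a * c) ⊗ (b * d)) t) s.

Definition tensv (F : fieldType) (U V : vectType F)
    (X : {vspace U}) (Y : {vspace V}) : {vspace tens U V} :=
  <<[seq u ⊗ v | u <- vbasis X, v <- vbasis Y]>>%VS.

Definition bilinear_map (F : fieldType) (U V W : lmodType F)
    (B : U -> V -> W) : Prop :=
  (forall v, linear (B^~ v)) /\ (forall u, linear (B u)).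

Section TensorTheory.

Variables (F : fieldType) (U V : vectType F).

Lemma tlift_is_linear (W : lmodType F) (B : U -> V -> W) : linear (tlift B).
Proof.
move=> a s t; rewrite /tlift scaler_sumr -big_split /=; apply: eq_bigr => i _.
rewrite scaler_sumr -big_split /=; apply: eq_bigr => j _.
by rewrite !mxE scalerDl scalerA.
Qed.

HB.instance Definition _ (W : lmodType F) (B : U -> V -> W) :=
  GRing.isSemilinear.Build F (tens U V) W _ (tlift B)
    (GRing.semilinear_linear (tlift_is_linear B)).

Lemma eq_tlift (W : lmodType F) (B B' : U -> V -> W) :
  (forall u v, B u v = B' u v) -> forall t, tlift B t = tlift B' t.
Proof.
by move=> eqB t; apply: eq_bigr => i _; apply: eq_bigr => j _; rewrite eqB.
Qed.

Lemma bilinear_sum (W : lmodType F) (B : U -> V -> W) m n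
    (a : 'I_m -> F) (x : 'I_m -> U) (b : 'I_n -> F) (y : 'I_n -> V) :
  bilinear_map B ->
  B (\sum_i a i *: x i) (\sum_j b j *: y j)
    = \sum_i \sum_j (a i * b j) *: B (x i) (y j).
Proof.
case=> Bl Br.
pose Lmix v := GRing.isSemilinear.Build F U W _ _
  (GRing.semilinear_linear (Bl v)).
pose L v : {linear U -> W} := HB.pack (B^~ v) (Lmix v).
pose Rmix u := GRing.isSemilinear.Build F V W _ _
  (GRing.semilinear_linear (Br u)).
pose R u : {linear V -> W} := HB.pack (B u) (Rmix u).
rewrite -[LHS]/(L _ _) linear_sum /=; apply: eq_bigr => i _.
rewrite -[B _ _]/(L _ _) linearZ /= -[B _ _]/(R _ _) linear_sum /= scaler_sumr.
by apply: eq_bigr => j _; rewrite -[B _ _]/(R _ _) linearZ /= scalerA.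
Qed.

Lemma tlift_ptens (W : lmodType F) (B : U -> V -> W) u v :
  bilinear_map B -> tlift B (u ⊗ v) = B u v.
Proof.
move=> bB.
rewrite {2}(coord_vbasis (memvf u)) {2}(coord_vbasis (memvf v)).
rewrite bilinear_sum //.
by apply: eq_bigr => i _; apply: eq_bigr => j _; rewrite mxE.
Qed.

Lemma ptens_bilinear : bilinear_map (@ptens F U V).
Proof.
split=> [v a u u' | u a v v']; apply/matrixP => i j; rewrite !mxE linearP /=.
  by rewrite mulrDl mulrA.
by rewrite mulrDr mulrCA.
Qed.

Lemma tensE (t : tens U V) : t = tlift (@ptens F U V) t.
Proof.
apply/matrixP => i j; rewrite /tlift summxE.
under eq_bigr => k _ do rewrite summxE.
have fU := basis_free (vbasisP {:U}); have fV := basis_free (vbasisP {:V}).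
rewrite (bigD1 i) //= (bigD1 j) //= !mxE !coord_free // !eqxx !mulr1.
rewrite big1 ?addr0 => [|k /negPf kj]; last first.
  by rewrite !mxE !coord_free // kj !mulr0.
rewrite big1 ?addr0 // => k /negPf ki; rewrite big1 // => l _.
by rewrite !mxE !coord_free // ki mul0r mulr0.
Qed.

Lemma tens_ext (W : lmodType F) (f g : {linear tens U V -> W}) :
  (forall u v, f (u ⊗ v) = g (u ⊗ v)) -> forall t, f t = g t.
Proof.
move=> fg t; rewrite (tensE t) /tlift !linear_sum; apply: eq_bigr => i _.
rewrite !linear_sum; apply: eq_bigr => j _.
by rewrite !linearZ /= fg.
Qed.

Lemma linear_tlift (W W' : lmodType F) (f : {linear W -> W'})
    (B : U -> V -> W) t :
  f (tlift B t) = tlift (fun u v => f (B u v)) t.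
Proof.
rewrite /tlift linear_sum; apply: eq_bigr => i _.
by rewrite linear_sum; apply: eq_bigr => j _; rewrite linearZ.
Qed.

Lemma memv_tens (X : {vspace U}) (Y : {vspace V}) u v :
  u \in X -> v \in Y -> u ⊗ v \in tensv X Y.
Proof.
move=> /coord_vbasis-> /coord_vbasis->; rewrite bilinear_sum; last first.
  exact: ptens_bilinear.
apply: memv_suml => i _; apply: memv_suml => j _.
apply/memvZ/memv_span/allpairsP.
by exists ((vbasis X)`_i, (vbasis Y)`_j); rewrite !memt_nth.
Qed.

Lemma tensv_ind (W : vectType F) (f : {linear tens U V -> W})
    (X : {vspace U}) (Y : {vspace V}) :
  (forall u v, u \in X -> v \in Y -> f (u ⊗ v) = 0) ->
  forall t, t \in tensv X Y -> f t = 0.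
Proof.
move=> f0 t XYt; suff: t \in lker (linfun f) by rewrite memv_ker lfunE => /eqP.
apply: subvP t XYt.
apply/span_subvP => _ /allpairsP[[u v] /= [uX vY ->]].
by rewrite memv_ker lfunE /= f0 ?vbasis_mem.
Qed.

Lemma tlift_param_linear (X W : lmodType F) (B : X -> U -> V -> W) t :
  (forall u v, linear (fun x => B x u v)) -> linear (fun x => tlift (B x) t).
Proof.
move=> Bl a x y; rewrite /tlift scaler_sumr -big_split /=; apply: eq_bigr => i _.
rewrite scaler_sumr -big_split /=; apply: eq_bigr => j _.
by rewrite Bl scalerDr !scalerA [_ * a]mulrC.
Qed.

End TensorTheory.

Section Bilinear.

Variable F : fieldType.

Lemma mul_bilinear (A : algType F) : bilinear_map (@GRing.mul A).
Proof.
split=> [v a u u' | u a v v'].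
  by rewrite mulrDl scalerAl.
by rewrite mulrDr scalerAr.
Qed.

Lemma scale_bilinear (W : lmodType F) :
  bilinear_map (fun (a : F^o) (w : W) => a *: w).
Proof.
split=> [v a u u' | u a v v'].
  by rewrite scalerDl scalerA.
by rewrite scalerDr !scalerA mulrC.
Qed.

Lemma bilinear_swap (U V W : lmodType F) (B : U -> V -> W) :
  bilinear_map B -> bilinear_map (fun v u => B u v).
Proof. by case. Qed.

Lemma bilinear_comp (U V W U' V' : lmodType F) (B : U -> V -> W)
    (f : U' -> U) (g : V' -> V) :
  bilinear_map B -> linear f -> linear g ->
  bilinear_map (fun u v => B (f u) (g v)).
Proof.
by case=> Bl Br lf lg; split=> [v a u u' | u a v v'] /=; rewrite ?lf ?lg ?Bl ?Br.
Qed.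

Lemma linear_bilinear (U V W W' : lmodType F) (B : U -> V -> W)
    (f : W -> W') :
  bilinear_map B -> linear f -> bilinear_map (fun u v => f (B u v)).
Proof.
by case=> Bl Br lf; split=> [v a u u' | u a v v'] /=; rewrite ?Bl ?Br lf.
Qed.

Definition tmap (U V U' V' : vectType F) (f : U -> U') (g : V -> V') :
    tens U V -> tens U' V' :=
  tlift (fun u v => f u ⊗ g v).

Lemma tlift_tmap (U V U' V' : vectType F) (W : lmodType F)
    (B : U' -> V' -> W) (f : U -> U') (g : V -> V') t :
  bilinear_map B -> tlift B (tmap f g t) = tlift (fun u v => B (f u) (g v)) t.
Proof.
move=> bB; rewrite (linear_tlift (tlift B)) /=.
by apply: eq_tlift => u v; rewrite tlift_ptens.
Qed.

Lemma tmul_ptens (A B : falgType F) (a c : A) (b d : B) :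
  tmul (a ⊗ b) (c ⊗ d) = (a * c) ⊗ (b * d).
Proof.
rewrite /tmul tlift_ptens; first rewrite tlift_ptens //.
  apply: bilinear_comp (ptens_bilinear _ _) _ _; exact: (mul_bilinear _).2.
split=> [v k u u' | u k v v']; last first.
  apply: (tlift_param_linear (B := fun v c d => (u * c) ⊗ (v * d))) => c1 d1.
  move=> k1 x y; rewrite mulrDl -scalerAl; exact: (ptens_bilinear _ _).2.
apply: (tlift_param_linear (B := fun u c d => (u * c) ⊗ (v * d))) => c1 d1.
move=> k1 x y; rewrite mulrDl -scalerAl; exact: (ptens_bilinear _ _).1.
Qed.

End Bilinear.

HB.mixin Record Falgebra_isHopf (F : fieldType) H of Falgebra F H := {
  comul : {linear H -> tens H H};
  counit : {linear H -> F^o};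
  antipode : {linear H -> H};
  comulA : forall h,
    tlift (fun a b => tlift (fun a1 a2 => a1 ⊗ (a2 ⊗ b)) (comul a)) (comul h)
    = tlift (fun a b => a ⊗ comul b) (comul h)
      :> tens H (tens H H);
  counitl : forall h, tlift (fun a b => counit a *: b) (comul h) = h;
  counitr : forall h, tlift (fun a b => counit b *: a) (comul h) = h;
  comul1 : comul 1 = 1 ⊗ 1;
  comulM : forall g h, comul (g * h) = tmul (comul g) (comul h);
  counit1 : counit 1 = 1;
  counitM : forall g h, counit (g * h) = counit g * counit h;
  antipodel : forall h,
    tlift (fun a b => antipode a * b) (comul h) = (counit h)%:A;
  antipoder : forall h,
    tlift (fun a b => a * antipode b) (comul h) = (counit h)%:A;
}.

#[short(type="hopfAlgType")]
HB.structure Definition HopfAlgebra (F : fieldType) :=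
  { H of Falgebra_isHopf F H & Falgebra F H }.

Definition cocommutative (F : fieldType) (H : hopfAlgType F) : Prop :=
  forall h : H, tswap (comul h) = comul h.

Section Dual.

Variables (F : fieldType) (H : hopfAlgType F).

Definition hopf_dual : Type := 'Hom(H, F^o).

HB.instance Definition _ := Vector.on hopf_dual.

Implicit Types f g k : hopf_dual.

Definition dual_app f (h : H) : F := (f : 'Hom(H, F^o)) h.

Definition dual_one : hopf_dual := linfun (@counit F H).

(* The convolution product. *)
Definition dual_mul f g : hopf_dual :=
  linfun (tlift (fun a b => (dual_app f a * dual_app g b : F^o)) \o comul).

Lemma dual_oneE h : dual_app dual_one h = counit h.
Proof. by rewrite /dual_app lfunE. Qed.

Lemma dual_mulE f g h :
  dual_app (dual_mul f g) h
    = tlift (fun a b => (dual_app f a * dual_app g b : F^o)) (comul h).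
Proof. by rewrite /dual_app lfunE. Qed.

Lemma dual_app_linear f : linear (dual_app f : H -> F^o).
Proof. by move=> a x y; rewrite /dual_app linearP. Qed.

Lemma dual_appP f g : (forall h, dual_app f h = dual_app g h) -> f = g.
Proof. by move=> fg; apply/lfunP => h; apply: fg. Qed.

Lemma dual_mul_bilinear : bilinear_map dual_mul.
Proof.
split=> [g a f f' | f a g g']; apply: dual_appP => h;
  rewrite [RHS]/dual_app add_lfunE scale_lfunE -!/(dual_app _ _) !dual_mulE.
  apply: (tlift_param_linear (W := F^o)
    (B := fun f a b => dual_app f a * dual_app g b)) => u v b x y.
  rewrite /dual_app add_lfunE scale_lfunE mulrDl; congr (_ + _).
  exact/esym/mulrA.
apply: (tlift_param_linear (W := F^o)
  (B := fun g a b => dual_app f a * dual_app g b)) => u v b x y.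
rewrite /dual_app add_lfunE scale_lfunE mulrDr; congr (_ + _).
exact: mulrCA.
Qed.

Lemma dual_mul_app_bilinear f g :
  bilinear_map (fun a b => dual_app f a * dual_app g b : F^o).
Proof.
exact: (bilinear_comp (mul_bilinear F^o) (@dual_app_linear f)
  (@dual_app_linear g)).
Qed.

Fact dual_mulA : associative dual_mul.
Proof.
move=> f g k; apply: dual_appP => h; rewrite !dual_mulE.
pose gk := tlift (fun a b => (dual_app g a * dual_app k b : F^o)).
pose T a s : F^o := dual_app f a * gk s.
have bT : bilinear_map T.
  apply: (bilinear_comp (mul_bilinear F^o) (@dual_app_linear f)).
  exact: tlift_is_linear.
transitivity (tlift T (tlift (fun a b => a ⊗ comul b) (comul h))).
  rewrite (linear_tlift (tlift T)); apply: (@eq_tlift F H H F^o) => a b.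
  by rewrite /= tlift_ptens // dual_mulE.
rewrite -comulA (linear_tlift (tlift T)); apply: (@eq_tlift F H H F^o) => a b.
rewrite dual_mulE /= (linear_tlift (tlift T)) /= mulrC.
have lk : linear (fun x : F^o => dual_app k b * x : F^o).
  exact: (mul_bilinear F^o).2.
pose km := GRing.isSemilinear.Build F F^o F^o _ _
  (GRing.semilinear_linear lk).
pose K : {linear F^o -> F^o} := HB.pack (fun x => dual_app k b * x) km.
rewrite -[RHS]/(K _) linear_tlift; apply: (@eq_tlift F H H F^o) => a1 a2 /=.
rewrite tlift_ptens // /T /gk tlift_ptens; last exact: dual_mul_app_bilinear.
by rewrite mulrA mulrC.
Qed.

Fact dual_mul1 : left_id dual_one dual_mul.
Proof.
move=> f; apply: dual_appP => h; rewrite dual_mulE -[in RHS](counitl h).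
rewrite [RHS]/dual_app linear_tlift; apply: (@eq_tlift F H H F^o) => a b /=.
by rewrite linearZ dual_oneE.
Qed.

Fact dual_mulr1 : right_id dual_one dual_mul.
Proof.
move=> f; apply: dual_appP => h; rewrite dual_mulE -[in RHS](counitr h).
rewrite [RHS]/dual_app linear_tlift; apply: (@eq_tlift F H H F^o) => a b /=.
by rewrite linearZ dual_oneE mulrC.
Qed.

Fact dual_mulDl : left_distributive dual_mul +%R.
Proof.
by move=> f f' g; have := dual_mul_bilinear.1 g 1 f f'; rewrite !scale1r.
Qed.

Fact dual_mulDr : right_distributive dual_mul +%R.
Proof.
by move=> f g g'; have := dual_mul_bilinear.2 f 1 g g'; rewrite !scale1r.
Qed.

Fact dual_one_neq0 : dual_one != 0.
Proof.
apply/eqP => /(congr1 (fun f => dual_app f 1)).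
rewrite dual_oneE counit1 /dual_app zero_lfunE => /eqP.
by rewrite oner_eq0.
Qed.

HB.instance Definition _ := GRing.Zmodule_isNzRing.Build hopf_dual
  dual_mulA dual_mul1 dual_mulr1 dual_mulDl dual_mulDr dual_one_neq0.

Fact dual_scaleAl (a : F) (f g : hopf_dual) : a *: (f * g) = (a *: f) * g.
Proof.
have := dual_mul_bilinear.1 g a f 0.
by rewrite !addr0 -[dual_mul 0 g]/(0 * g) mul0r addr0 => /esym.
Qed.

HB.instance Definition _ :=
  GRing.Lmodule_isLalgebra.Build F hopf_dual dual_scaleAl.

Fact dual_scaleAr (a : F) (f g : hopf_dual) : a *: (f * g) = f * (a *: g).
Proof.
have := dual_mul_bilinear.2 f a g 0.
by rewrite !addr0 -[dual_mul f 0]/(f * 0) mulr0 addr0 => /esym.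
Qed.

HB.instance Definition _ :=
  GRing.Lalgebra_isAlgebra.Build F hopf_dual dual_scaleAr.

HB.instance Definition _ := Algebra_isFalgebra.Build F hopf_dual.

End Dual.

(* The Hopf ideals of H; the counit condition makes them proper. *)
Record hopf_ideal (F : fieldType) (H : hopfAlgType F) := HopfIdeal {
  hopf_idealv :> {vspace H};
  hopf_ideall : (fullv * hopf_idealv <= hopf_idealv)%VS;
  hopf_idealr : (hopf_idealv * fullv <= hopf_idealv)%VS;
  hopf_ideal_comul : forall x, x \in hopf_idealv ->
    comul x \in (tensv hopf_idealv fullv + tensv fullv hopf_idealv)%VS;
  hopf_ideal_counit : forall x, x \in hopf_idealv -> counit x = 0;
  hopf_ideal_antipode : forall x, x \in hopf_idealv ->
    antipode x \in hopf_idealv;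
}.

(* H / I, carried by the complement of I; [quot_pi] is the canonical
   projection, a surjection with kernel I. *)
Section Quotient.

Variables (F : fieldType) (H : hopfAlgType F) (I : hopf_ideal H).

Definition hopf_quot : Type := subvs_of (I^C)%VS.

HB.instance Definition _ := Vector.on hopf_quot.

Definition quot_repr (x : hopf_quot) : H := vsval x.

Definition quot_pi (h : H) : hopf_quot := vsproj (I^C)%VS (daddv_pi (I^C)%VS I h).

Lemma quot_pi_is_linear : linear quot_pi.
Proof. by move=> a x y; rewrite /quot_pi !linearP. Qed.

HB.instance Definition _ := GRing.isSemilinear.Build F H hopf_quot _ quot_pi
  (GRing.semilinear_linear quot_pi_is_linear).

Let dxI : (I^C :&: I = 0)%VS. Proof. by rewrite capvC capv_compl. Qed.

Lemma quot_reprK : cancel quot_repr quot_pi.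
Proof.
by move=> x; rewrite /quot_pi daddv_pi_id // ?subvsP // /quot_repr vsvalK.
Qed.

Lemma quot_pi_eq0 h : (quot_pi h == 0) = (h \in hopf_idealv I).
Proof.
have sumI : h \in (I^C + I)%VS by rewrite addvC addv_complf memvf.
have dec := daddv_pi_add dxI sumI; apply/eqP/idP => [|Ih].
  move/(congr1 vsval); rewrite /quot_pi vsprojK ?memv_pi //= => h0.
  by rewrite -dec h0 add0r memv_pi.
have := daddv_pi_id (etrans (capvC _ _) dxI) Ih => IhE.
rewrite IhE in dec; rewrite /quot_pi.
by rewrite (_ : daddv_pi _ _ h = 0) ?linear0 // -(addrK h (daddv_pi _ _ _)) dec subrr.
Qed.

Lemma quot_pi_repr h : quot_repr (quot_pi h) - h \in hopf_idealv I.
Proof. by rewrite -quot_pi_eq0 linearB /= quot_reprK subrr. Qed.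

Definition quot_one : hopf_quot := quot_pi 1.

Definition quot_mul (x y : hopf_quot) : hopf_quot :=
  quot_pi (quot_repr x * quot_repr y).

Lemma quot_pi_mul a b : quot_pi (a * b) = quot_mul (quot_pi a) (quot_pi b).
Proof.
apply/esym/eqP; rewrite -subr_eq0 -linearB /= quot_pi_eq0.
set a' := quot_repr _; set b' := quot_repr _.
have -> : a' * b' - a * b = (a' - a) * b' + a * (b' - b).
  by rewrite mulrBl mulrBr addrA subrK.
apply: memvD.
  by apply: (subvP (hopf_idealr I)); rewrite memv_mul ?memvf ?quot_pi_repr.
by apply: (subvP (hopf_ideall I)); rewrite memv_mul ?memvf ?quot_pi_repr.
Qed.

Fact quot_mulA : associative quot_mul.
Proof.
move=> x y z; rewrite -(quot_reprK x) -(quot_reprK y) -(quot_reprK z).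
by rewrite -!quot_pi_mul mulrA.
Qed.

Fact quot_mul1 : left_id quot_one quot_mul.
Proof. by move=> x; rewrite -(quot_reprK x) -quot_pi_mul mul1r. Qed.

Fact quot_mulr1 : right_id quot_one quot_mul.
Proof. by move=> x; rewrite -(quot_reprK x) -quot_pi_mul mulr1. Qed.

Fact quot_mulDl : left_distributive quot_mul +%R.
Proof.
move=> x y z; rewrite -(quot_reprK x) -(quot_reprK y) -(quot_reprK z).
by rewrite -linearD -!quot_pi_mul mulrDl linearD.
Qed.

Fact quot_mulDr : right_distributive quot_mul +%R.
Proof.
move=> x y z; rewrite -(quot_reprK x) -(quot_reprK y) -(quot_reprK z).
by rewrite -linearD -!quot_pi_mul mulrDr linearD.
Qed.

Fact quot_one_neq0 : quot_one != 0.
Proof.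
rewrite quot_pi_eq0; apply/negP => /hopf_ideal_counit /eqP.
by rewrite counit1 oner_eq0.
Qed.

HB.instance Definition _ := GRing.Zmodule_isNzRing.Build hopf_quot
  quot_mulA quot_mul1 quot_mulr1 quot_mulDl quot_mulDr quot_one_neq0.

Lemma quot_piM a b : quot_pi (a * b) = quot_pi a * quot_pi b.
Proof. exact: quot_pi_mul. Qed.

Lemma quot_pi1 : quot_pi 1 = 1.
Proof. by []. Qed.

Fact quot_scaleAl (a : F) (x y : hopf_quot) : a *: (x * y) = (a *: x) * y.
Proof.
rewrite -(quot_reprK x) -(quot_reprK y).
by rewrite -quot_piM -!linearZ /= -quot_piM scalerAl.
Qed.

HB.instance Definition _ :=
  GRing.Lmodule_isLalgebra.Build F hopf_quot quot_scaleAl.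

Fact quot_scaleAr (a : F) (x y : hopf_quot) : a *: (x * y) = x * (a *: y).
Proof.
rewrite -(quot_reprK x) -(quot_reprK y).
by rewrite -quot_piM -!linearZ /= -quot_piM scalerAr.
Qed.

HB.instance Definition _ :=
  GRing.Lalgebra_isAlgebra.Build F hopf_quot quot_scaleAr.

HB.instance Definition _ := Algebra_isFalgebra.Build F hopf_quot.

Definition quot_comul (x : hopf_quot) : tens hopf_quot hopf_quot :=
  tmap quot_pi quot_pi (comul (quot_repr x)).

Definition quot_counit (x : hopf_quot) : F^o := counit (quot_repr x).

Definition quot_antipode (x : hopf_quot) : hopf_quot :=
  quot_pi (antipode (quot_repr x)).

Lemma quot_comulE h : quot_comul (quot_pi h) = tmap quot_pi quot_pi (comul h).
Proof.
apply/eqP; rewrite /quot_comul -subr_eq0 /tmap -!linearB /=; apply/eqP.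
have /hopf_ideal_comul/memv_addP[s Is [t It ->]] := quot_pi_repr h.
have pi0 x : x \in hopf_idealv I -> quot_pi x = 0.
  by rewrite -quot_pi_eq0 => /eqP.
have [bl br] := ptens_bilinear hopf_quot hopf_quot.
have bpp : bilinear_map (fun a b => quot_pi a ⊗ quot_pi b).
  exact: (bilinear_comp (conj bl br) quot_pi_is_linear quot_pi_is_linear).
have ptens0l (v : hopf_quot) : (0 : hopf_quot) ⊗ v = 0.
  by have := bl v (-1) 0 0; rewrite scaler0 addr0 scaleN1r addNr.
have ptens0r (u : hopf_quot) : u ⊗ (0 : hopf_quot) = 0.
  by have := br u (-1) 0 0; rewrite scaler0 addr0 scaleN1r addNr.
rewrite linearD /=.
rewrite (tensv_ind _ Is) ?(tensv_ind _ It) ?addr0 // => u v Iu Iv /=;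
  by rewrite tlift_ptens // ?(pi0 u Iu) ?(pi0 v Iv).
Qed.

Lemma quot_counitE h : quot_counit (quot_pi h) = counit h.
Proof.
apply/eqP; rewrite /quot_counit -subr_eq0 -linearB /=.
by rewrite (hopf_ideal_counit (quot_pi_repr h)).
Qed.

Lemma quot_antipodeE h : quot_antipode (quot_pi h) = quot_pi (antipode h).
Proof.
apply/eqP; rewrite /quot_antipode -subr_eq0 -!linearB /= quot_pi_eq0.
exact: (hopf_ideal_antipode (quot_pi_repr h)).
Qed.

Lemma quot_comul_is_linear : linear quot_comul.
Proof.
move=> a x y; rewrite -(quot_reprK x) -(quot_reprK y) -linearP !quot_comulE.
by rewrite /tmap !linearP.
Qed.

Lemma quot_counit_is_linear : linear quot_counit.
Proof. by move=> a x y; rewrite /quot_counit /quot_repr !linearP. Qed.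

Lemma quot_antipode_is_linear : linear quot_antipode.
Proof.
move=> a x y; rewrite -(quot_reprK x) -(quot_reprK y) -linearP !quot_antipodeE.
by rewrite !linearP.
Qed.

HB.instance Definition _ := GRing.isSemilinear.Build F hopf_quot _ _ quot_comul
  (GRing.semilinear_linear quot_comul_is_linear).
HB.instance Definition _ := GRing.isSemilinear.Build F hopf_quot F^o _
  quot_counit (GRing.semilinear_linear quot_counit_is_linear).
HB.instance Definition _ := GRing.isSemilinear.Build F hopf_quot hopf_quot _
  quot_antipode (GRing.semilinear_linear quot_antipode_is_linear).

Fact quot_comulA (x : hopf_quot) :
  tlift (fun a b => tlift (fun a1 a2 => a1 ⊗ (a2 ⊗ b)) (quot_comul a))
    (quot_comul x)
  = tlift (fun a b => a ⊗ quot_comul b) (quot_comul x)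
    :> tens hopf_quot (tens hopf_quot hopf_quot).
Proof.
have bQ := ptens_bilinear hopf_quot hopf_quot.
have bQ3 := ptens_bilinear hopf_quot (tens hopf_quot hopf_quot).
have b1 (b : hopf_quot) : bilinear_map (fun a1 a2 : hopf_quot => a1 ⊗ (a2 ⊗ b)).
  by apply: (bilinear_comp (f := id) bQ3) => //; apply: bQ.1.
rewrite -(quot_reprK x); set h := quot_repr x; rewrite quot_comulE.
have bl : bilinear_map (fun a b : hopf_quot =>
    tlift (fun a1 a2 => a1 ⊗ (a2 ⊗ b)) (quot_comul a)).
  split=> [v a u u' | u a v v'].
    by rewrite (quot_comul_is_linear a u u') linearP.
  apply: (tlift_param_linear (B := fun b a1 a2 => a1 ⊗ (a2 ⊗ b))) => c d k y z.
  by rewrite bQ.2 bQ3.2.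
have br : bilinear_map (fun a b : hopf_quot => a ⊗ quot_comul b).
  by apply: (bilinear_comp (f := id) bQ3) => //; exact: quot_comul_is_linear.
rewrite (tlift_tmap _ _ _ bl) (tlift_tmap _ _ _ br).
pose T := tmap quot_pi (tmap quot_pi quot_pi).
have bT : bilinear_map (fun a s => quot_pi a ⊗ tmap quot_pi quot_pi s).
  by apply: (bilinear_comp bQ3) => [|k y z]; rewrite ?/tmap ?linearP //;
     exact: quot_pi_is_linear.
have bpp : bilinear_map (fun a b => quot_pi a ⊗ quot_pi b).
  exact: (bilinear_comp bQ quot_pi_is_linear quot_pi_is_linear).
transitivity (T (tlift (fun a b => a ⊗ comul b) (comul h))); last first.
  rewrite /T /tmap (linear_tlift (tlift _)); apply: eq_tlift => a b /=.
  by rewrite tlift_ptens // quot_comulE.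
rewrite -comulA /T {1}/tmap (linear_tlift (tlift _)); apply: eq_tlift => a b /=.
rewrite quot_comulE tlift_tmap // (linear_tlift (tlift _)).
apply: eq_tlift => a1 a2 /=.
by rewrite tlift_ptens // {1}/tmap tlift_ptens.
Qed.

Fact quot_counitl (x : hopf_quot) :
  tlift (fun a b => quot_counit a *: b) (quot_comul x) = x.
Proof.
rewrite -(quot_reprK x); set h := quot_repr x; rewrite quot_comulE.
rewrite tlift_tmap.
  rewrite -[in RHS](counitl h) linear_tlift; apply: eq_tlift => a b /=.
  by rewrite quot_counitE linearZ.
have bS := scale_bilinear hopf_quot.
by apply: (bilinear_comp (g := id) bS quot_counit_is_linear).
Qed.

Fact quot_counitr (x : hopf_quot) :
  tlift (fun a b => quot_counit b *: a) (quot_comul x) = x.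
Proof.
rewrite -(quot_reprK x); set h := quot_repr x; rewrite quot_comulE.
rewrite tlift_tmap.
  rewrite -[in RHS](counitr h) linear_tlift; apply: eq_tlift => a b /=.
  by rewrite quot_counitE linearZ.
apply: (bilinear_swap (B := fun b a => quot_counit b *: a)).
have bS := scale_bilinear hopf_quot.
by apply: (bilinear_comp (g := id) bS quot_counit_is_linear).
Qed.

Fact quot_comul1 : quot_comul 1 = 1 ⊗ 1.
Proof.
rewrite -{1}quot_pi1 quot_comulE comul1 /tmap tlift_ptens ?quot_pi1 //.
exact: (bilinear_comp (ptens_bilinear _ _) quot_pi_is_linear quot_pi_is_linear).
Qed.

Fact quot_comulM (x y : hopf_quot) :
  quot_comul (x * y) = tmul (quot_comul x) (quot_comul y).
Proof.
have bQ := ptens_bilinear hopf_quot hopf_quot.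
have bpp : bilinear_map (fun a b => quot_pi a ⊗ quot_pi b).
  exact: (bilinear_comp bQ quot_pi_is_linear quot_pi_is_linear).
rewrite -(quot_reprK x) -(quot_reprK y) -quot_piM !quot_comulE comulM.
rewrite {1}/tmul /tmap (linear_tlift (tlift _)) /=.
have lmul (t : tens hopf_quot hopf_quot) : linear (fun s => tmul s t).
  by move=> k s s'; rewrite /tmul linearP.
have rmul (s : tens hopf_quot hopf_quot) : linear (tmul s).
  move=> k t t'; apply: (tlift_param_linear (B := fun t a b =>
    tlift (fun c d => (a * c) ⊗ (b * d)) t)) => a b k' u u'.
  by rewrite linearP.
pose Lm t := GRing.isSemilinear.Build F _ _ _ _
  (GRing.semilinear_linear (lmul t)).
pose L t : {linear tens hopf_quot hopf_quot -> tens hopf_quot hopf_quot} :=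
  HB.pack (fun s => tmul s t) (Lm t).
pose Rm s := GRing.isSemilinear.Build F _ _ _ _
  (GRing.semilinear_linear (rmul s)).
pose R s : {linear tens hopf_quot hopf_quot -> tens hopf_quot hopf_quot} :=
  HB.pack (tmul s) (Rm s).
rewrite -[RHS]/(L _ _) linear_tlift; apply: eq_tlift => a b.
rewrite -[RHS]/(R _ _) !linear_tlift; apply: eq_tlift => c d /=.
by rewrite tlift_ptens // tmul_ptens !quot_piM.
Qed.

Fact quot_counit1 : quot_counit 1 = 1.
Proof. by rewrite -quot_pi1 quot_counitE counit1. Qed.

Fact quot_counitM (x y : hopf_quot) :
  quot_counit (x * y) = quot_counit x * quot_counit y.
Proof.
rewrite -(quot_reprK x) -(quot_reprK y) -quot_piM !quot_counitE.
exact: counitM.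
Qed.

Fact quot_antipodel (x : hopf_quot) :
  tlift (fun a b => quot_antipode a * b) (quot_comul x) = (quot_counit x)%:A.
Proof.
rewrite -(quot_reprK x) quot_comulE quot_counitE tlift_tmap.
  rewrite -quot_pi1 -linearZ /= -antipodel linear_tlift.
  by apply: eq_tlift => a b /=; rewrite quot_antipodeE quot_piM.
by apply: (bilinear_comp (g := id) (mul_bilinear _) quot_antipode_is_linear).
Qed.

Fact quot_antipoder (x : hopf_quot) :
  tlift (fun a b => a * quot_antipode b) (quot_comul x) = (quot_counit x)%:A.
Proof.
rewrite -(quot_reprK x) quot_comulE quot_counitE tlift_tmap.
  rewrite -quot_pi1 -linearZ /= -antipoder linear_tlift.
  by apply: eq_tlift => a b /=; rewrite quot_antipodeE quot_piM.
by apply: (bilinear_comp (f := id) (mul_bilinear _) _ quot_antipode_is_linear).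
Qed.

HB.instance Definition _ := Falgebra_isHopf.Build F hopf_quot
  quot_comulA quot_counitl quot_counitr quot_comul1 quot_comulM
  quot_counit1 quot_counitM quot_antipodel quot_antipoder.

End Quotient.

Definition left_ideal (F : fieldType) (A : falgType F) (L : {vspace A}) : bool :=
  (fullv * L <= L)%VS.

Definition simple_left_ideal (F : fieldType) (A : falgType F)
    (L : {vspace A}) : Prop :=
  [/\ left_ideal L, L != 0%VS
    & forall K : {vspace A}, left_ideal K -> (K <= L)%VS ->
        K = 0%VS \/ K = L].

(* The left regular module is a direct sum of simple modules. *)
Definition semisimple (F : fieldType) (A : falgType F) : Prop :=
  exists (n : nat) (L : 'I_n -> {vspace A}),
    [/\ forall i, simple_left_ideal (L i),
        directv (\sum_i L i)
      & (\sum_i L i)%VS = fullv].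

Definition cosemisimple (F : fieldType) (H : hopfAlgType F) : Prop :=
  semisimple (hopf_dual H).

Record module_algebra (F : fieldType) (H : hopfAlgType F) (D : algType F)
    (act : H -> D -> D) : Prop := ModuleAlgebra {
  act_linearl : forall x, linear (act^~ x);
  act_linearr : forall h, linear (act h);
  act_id : forall x, act 1 x = x;
  act_comp : forall g h x, act (g * h) x = act g (act h x);
  act_mul : forall h x y,
    act h (x * y) = tlift (fun a b => act a x * act b y) (comul h);
  act_one : forall h, act h 1 = (counit h)%:A;
}.

Definition invariant_elt (F : fieldType) (H : hopfAlgType F) (D : algType F)
    (act : H -> D -> D) (a : D) : Prop :=
  forall h, act h a = counit h *: a.

Definition factors_cocommutative (F : fieldType) (H : hopfAlgType F)
    (D : algType F) (act : H -> D -> D) : Prop :=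
  exists I : hopf_ideal H,
    (forall h x, h \in hopf_idealv I -> act h x = 0)
    /\ cocommutative (hopf_quot I).

Definition central (D : pzRingType) (z : D) : Prop :=
  forall x, z * x = x * z.

Definition subalgebra (F : fieldType) (D : algType F) (S : D -> Prop) : Prop :=
  [/\ S 1, forall (a : F) x y, S x -> S y -> S (a *: x + y)
    & forall x y, S x -> S y -> S (x * y)].

Definition center_invariants (F : fieldType) (H : hopfAlgType F)
    (D : algType F) (act : H -> D -> D) (x : D) : Prop :=
  forall S : D -> Prop, subalgebra S ->
    (forall z, central z -> S z) -> (forall a, invariant_elt act a -> S a) ->
    S x.

Definition division_ring (D : unitRingType) : Prop :=
  forall x : D, x != 0 -> x \is a GRing.unit.

(* [D : Z] = n, for D a left vector space over its center Z. *)
Definition dim_over_center (D : pzRingType) (n : nat) : Prop :=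
  exists e : 'I_n -> D,
    (forall x, exists2 z : 'I_n -> D,
       forall i, central (z i) & x = \sum_i z i * e i)
    /\ (forall z : 'I_n -> D, (forall i, central (z i)) ->
          \sum_i z i * e i = 0 -> forall i, z i = 0).

Definition division_algebra_of_degree (F : fieldType) (D : unitAlgType F)
    (m : nat) : Prop :=
  division_ring D /\ dim_over_center D (m ^ 2).

Lemma center_invariantsP (F : fieldType) (H : hopfAlgType F) (D : algType F)
    (act : H -> D -> D) (x : D) :
  module_algebra act ->
  center_invariants act x <->
  exists2 s : seq (D * D),
    forall p, p \in s -> central p.1 /\ invariant_elt act p.2
    & x = \sum_(p <- s) p.1 * p.2.
Proof.
move=> actD; have zc1 : central (1 : D) by move=> y; rewrite mulr1 mul1r.
have inv1 : invariant_elt act 1 by move=> h; rewrite (act_one actD).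
have invM a b : invariant_elt act a -> invariant_elt act b ->
    invariant_elt act (a * b).
  move=> ia ib h; rewrite (act_mul actD).
  have lB : linear (fun k : H => (counit k : F) *: (a * b)).
    by move=> c y z; rewrite linearP /= scalerDl scalerA.
  pose Bm := GRing.isSemilinear.Build F H D _ _ (GRing.semilinear_linear lB).
  pose L : {linear H -> D} := HB.pack (fun k => (counit k : F) *: (a * b)) Bm.
  rewrite -[in RHS](counitl h) -[RHS]/(L _) linear_tlift.
  apply: eq_tlift => g k /=; rewrite ia ib linearZ /=.
  by rewrite -scalerAl -scalerAr scalerA.
split=> [|[s sP ->] S [S1 Sl SM] Sz Sa]; last first.
  have S0 : S 0 by have := Sl (-1) 1 1 S1 S1; rewrite scaleN1r addNr.
  rewrite big_seq; elim/big_ind: _ => // [y z Sy Sz'|p /sP[zp ip]].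
    by have := Sl 1 _ _ Sy Sz'; rewrite scale1r.
  by apply: SM; [apply: Sz|apply: Sa].
pose S y := exists2 s : seq (D * D),
  forall p, p \in s -> central p.1 /\ invariant_elt act p.2
  & y = \sum_(p <- s) p.1 * p.2.
move=> cx; apply: (cx S); last 2 first.
- move=> z zz; exists [:: (z, 1)] => [p|]; last by rewrite big_seq1 mulr1.
  by rewrite inE => /eqP->.
- move=> a ia; exists [:: (1, a)] => [p|]; last by rewrite big_seq1 mul1r.
  by rewrite inE => /eqP->.
split.
- exists [:: (1, 1)] => [p|]; last by rewrite big_seq1 mulr1.
  by rewrite inE => /eqP->.
- move=> c y z [s sP ->] [t tP ->].
  exists ([seq (c *: p.1, p.2) | p <- s] ++ t) => [p|].
    rewrite mem_cat => /orP[/mapP[q /sP[zq iq] ->]|/tP//]; split=> // w /=.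
    by rewrite -scalerAl zq scalerAr.
  rewrite big_cat big_map scaler_sumr; congr (_ + _).
  by apply: eq_bigr => p _; rewrite scalerAl.
- move=> y z [s sP ->] [t tP ->].
  exists [seq (p.1 * q.1, p.2 * q.2) | p <- s, q <- t] => [r|].
    case/allpairsP=> [[p q] /= [/sP[zp ip] /tP[zq iq] ->]]; split=> /=.
      by move=> w; rewrite -mulrA zq !mulrA zp.
    exact: invM.
  rewrite big_allpairs_dep mulr_suml !big_seq; apply: eq_bigr => p /sP[zp ip].
  rewrite mulr_sumr !big_seq; apply: eq_bigr => q /tP[zq iq] /=.
  by rewrite !mulrA -[p.1 * p.2 * q.1]mulrA -zq mulrA.
Qed.

(* Main.v *)
Require Import Defs.
From HB Require Import structures.
From mathcomp Require Import all_boot all_algebra all_field.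
From mathcomp Require Import boolp zify.

Set Implicit Arguments.
Unset Strict Implicit.
Unset Printing Implicit Defensive.

Import GRing.Theory.

Local Open Scope ring_scope.

(** Part (i).  By Artin's argument for linear independence, a family of D that
    is left independent over D^H has at most dim H = d elements, because its
    orbit maps h |-> h . x_j are left independent over D.  Hence
    k = [D : Z D^H] <= d; as k divides [D : Z] = m^2 and d! is prime to m,
    k = 1.  If z is central then h . z commutes with Z and with D^H, so it is
    central.

    Part (ii).  By (i) it is enough to treat the action on the field Z.  Let t
    be a two-sided integral of H with counit 1.  The form (x, y) |-> t . (x y)
    on Z over Z^H is nondegenerate; let a_i, a'_i be dual bases and put
    w(h) = \sum_i a_i (h . a'_i).  The annihilator I of Z is
    {h | w (h g) = 0 for all g}.  If w takes its values in F, this implies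
    that I is a Hopf ideal and that H / I is cocommutative, because w and its
    translates commute in Z (x) H^*.

    If w had a nonconstant value, then w / v0 would specialise, at a place of
    Z with values in F where some v0 = w(h0) has a pole, to a functional y on
    H.  The translates of y generate an ideal N in a commutative translation
    stable subalgebra of H^*, and every element of N vanishes at t since
    w(t) = 1 is negligible against v0.  A power of N has a unit f, which has to
    be invariant and to vanish at t, so f = 0; thus N is nilpotent, in
    contradiction with y(h0) = 1. *)

(** * Subspaces given by predicates, unbundled linear maps, Sweedler sums *)

(** A subspace inside [P] is enlarged by one vector of [P] at a time; the codimension bounds the
    number of enlargements. *)
Lemma ex_vspace (K : fieldType) (V : vectType K) (P : V -> Prop) :
  P 0 -> (forall a x y, P x -> P y -> P (a *: x + y)) ->
  exists U : {vspace V}, forall x, x \in U <-> P x.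
Proof.
move=> P0 Pl.
suff ext k (U : {vspace V}) : (forall x, x \in U -> P x) ->
    (\dim {:V} - \dim U <= k)%N ->
      exists U : {vspace V}, forall x, x \in U <-> P x.
  by apply: (ext _ 0%VS) (leqnn _) => x; rewrite memv0 => /eqP->.
elim: k U => [|k IHk] U UP.
  rewrite leqn0 subn_eq0 => dimU; exists U => x; split=> [/UP//|_].
  suff -> : U = fullv by rewrite memvf.
  by apply/eqP; rewrite eqEdim subvf.
move=> dimU; have [[x [Px xU]]|nx] := pselect (exists x, P x /\ x \notin U).
  apply: (IHk (U + <[x]>)%VS) => [y /memv_addP[u Uu [v /vlineP[a ->] ->]]|].
    by rewrite addrC; apply: Pl => //; apply: UP.
  have Uproper : (\dim U < \dim (U + <[x]>))%N.
    rewrite ltn_neqAle dimvS ?addvSl // andbT; apply: contraNneq xU => eqd.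
    suff -> : U = (U + <[x]>)%VS by rewrite memvE addvSr.
    by apply/eqP; rewrite eqEdim addvSl eqd leqnn.
  move: dimU; rewrite !leq_subLR => /leq_trans; apply.
  by rewrite addnS -addSn leq_add2r.
exists U => x; split=> [/UP//|Px]; apply/negPn/negP => xU; apply: nx.
by exists x.
Qed.

Section LinearFor.

Variables (R : pzRingType) (U V : lmodType R) (f : U -> V).
Hypothesis lf : linear f.

Lemma linear_for0 : f 0 = 0.
Proof. by have := lf (-1) 0 0; rewrite scaler0 addr0 scaleN1r addNr. Qed.

Lemma linear_forZ a x : f (a *: x) = a *: f x.
Proof. by rewrite -[a *: x]addr0 lf linear_for0 addr0. Qed.

Lemma linear_forD x y : f (x + y) = f x + f y.
Proof. by rewrite -[x]scale1r lf !scale1r. Qed.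

Lemma linear_forB x y : f (x - y) = f x - f y.
Proof. by rewrite -[- y]scaleN1r linear_forD linear_forZ scaleN1r. Qed.

Lemma linear_for_sum I (r : seq I) (P : pred I) (g : I -> U) :
  f (\sum_(i <- r | P i) g i) = \sum_(i <- r | P i) f (g i).
Proof. exact: (big_morph f linear_forD linear_for0). Qed.

End LinearFor.

Section Sweedler.

Variable F : fieldType.

Lemma tlift_comp (U V : vectType F) (W W' : lmodType F) (f : W -> W')
    (B : U -> V -> W) t :
  linear f -> f (tlift B t) = tlift (fun u v => f (B u v)) t.
Proof.
move=> lf; pose fm := GRing.isSemilinear.Build F W W' _ _
  (GRing.semilinear_linear lf).
pose L : {linear W -> W'} := HB.pack f fm.
by rewrite -[LHS]/(L _) linear_tlift.
Qed.

Lemma tliftD (U V : vectType F) (W : lmodType F) (B B' : U -> V -> W) t :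
  tlift B t + tlift B' t = tlift (fun u v => B u v + B' u v) t.
Proof.
rewrite /tlift -big_split; apply: eq_bigr => i _; rewrite -big_split.
by apply: eq_bigr => j _; rewrite scalerDr.
Qed.

Lemma tlift_sum (U V : vectType F) (W : lmodType F) I (r : seq I)
    (B : I -> U -> V -> W) t :
  \sum_(i <- r) tlift (B i) t = tlift (fun u v => \sum_(i <- r) B i u v) t.
Proof.
rewrite /tlift exchange_big; apply: eq_bigr => i _; rewrite exchange_big.
by apply: eq_bigr => j _; rewrite scaler_sumr.
Qed.

Lemma tlift_eq0 (U V : vectType F) (W : lmodType F) (B : U -> V -> W) t :
  (forall u v, B u v = 0) -> tlift B t = 0.
Proof.
by move=> B0; rewrite /tlift big1 // => i _; rewrite big1 // => j _;
  rewrite B0 scaler0.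
Qed.

Lemma memv_tlift (U V W : vectType F) (X : {vspace W}) (B : U -> V -> W) t :
  (forall u v, B u v \in X) -> tlift B t \in X.
Proof.
move=> XB; apply: memv_suml => i _; apply: memv_suml => j _.
exact/memvZ/XB.
Qed.

Lemma exchange_tlift (U V U' V' : vectType F) (W : lmodType F)
    (B : U -> V -> U' -> V' -> W) s t :
  tlift (fun a b => tlift (B a b) t) s
    = tlift (fun c d => tlift (fun a b => B a b c d) s) t.
Proof.
rewrite /tlift; under eq_bigr => i _.
  under eq_bigr => j _.
    rewrite scaler_sumr; under eq_bigr => k _ do rewrite scaler_sumr.
    over.
  rewrite exchange_big /=; under eq_bigr => k _ do rewrite exchange_big /=.
  over.
rewrite exchange_big /=; apply: eq_bigr => k _.
rewrite exchange_big /=; apply: eq_bigr => l _.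
rewrite scaler_sumr; apply: eq_bigr => i _.
rewrite !scaler_sumr; apply: eq_bigr => j _.
by rewrite !scalerA mulrC.
Qed.

Lemma tlift_tswap (U V : vectType F) (W : lmodType F) (B : V -> U -> W) s :
  bilinear_map B -> tlift B (tswap s) = tlift (fun u v => B v u) s.
Proof.
move=> bB; rewrite /tswap (linear_tlift (tlift B)).
by apply: eq_tlift => u v /=; rewrite tlift_ptens.
Qed.

Lemma linfunE (U V : vectType F) (f : U -> V) u : linear f -> linfun f u = f u.
Proof.
move=> lf; pose fm := GRing.isSemilinear.Build F U V _ _
  (GRing.semilinear_linear lf).
pose L : {linear U -> V} := HB.pack f fm.
by rewrite -[linfun f]/(linfun L) lfunE.
Qed.

Variable H : hopfAlgType F.

(** A trilinear [T] induces a linear map on the triple tensor product, and both sides are its value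
    at the iterated coproduct, bracketed in two ways. *)
Lemma comul_coassoc (W : lmodType F) (T : H -> H -> H -> W) h :
  (forall b c, linear (fun a => T a b c)) ->
  (forall a c, linear (fun b => T a b c)) -> (forall a b, linear (T a b)) ->
  tlift (fun a b => tlift (fun a1 a2 => T a1 a2 b) (comul a)) (comul h)
    = tlift (fun a b => tlift (T a) (comul b)) (comul h).
Proof.
move=> T1 T2 T3.
have bT a : bilinear_map (T a) by split.
have bTT : bilinear_map (fun a s => tlift (T a) s).
  split=> [s|a]; first by apply: (tlift_param_linear (B := T)) => u v;
    apply: T1.
  exact: tlift_is_linear.
transitivity (tlift (fun a s => tlift (T a) s)
    (tlift (fun a b => tlift (fun a1 a2 =>
      a1 ⊗ (a2 ⊗ b)) (comul a)) (comul h))).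
  rewrite (linear_tlift (tlift _)); apply: eq_tlift => a b /=.
  rewrite (linear_tlift (tlift _)); apply: eq_tlift => a1 a2 /=.
  by rewrite tlift_ptens // tlift_ptens.
rewrite comulA (linear_tlift (tlift _)); apply: eq_tlift => a b /=.
by rewrite tlift_ptens.
Qed.

(** Both sides equal the sum of (h1 . x) (h2 S(h3) . y): the antipode contracts h2 S(h3), while
    coassociativity and [act_mul] join h1 with h2. *)
Lemma module_algebra_mulC (A : algType F) (act : H -> A -> A)
    (actA : module_algebra act) h x y :
  act h x * y
    = tlift (fun a b => act a (x * act (antipode b) y)) (comul h).
Proof.
have [actl actr act1 actM actxM actx1] := actA.
pose T a b c := act a x * act (b * antipode c) y.
transitivity (tlift (fun a b => tlift (T a) (comul b)) (comul h)).
  transitivity (tlift (fun a b => counit b *: (act a x * y)) (comul h)).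
    rewrite -{1}(counitr h) (tlift_comp (f := fun k => act k x * y)).
      by apply: eq_tlift => a b; rewrite (linear_forZ (actl x)) scalerAl.
    by move=> a u v; rewrite actl mulrDl scalerAl.
  apply: eq_tlift => a b; rewrite /T.
  rewrite -(tlift_comp (f := fun k => act a x * act k y)) => [|c u v].
    by rewrite antipoder (linear_forZ (actl y)) act1 scalerAr.
  by rewrite actl mulrDr scalerAr.
rewrite -comul_coassoc.
- apply: eq_tlift => a b; rewrite actxM; apply: eq_tlift => a1 a2.
  by rewrite /T actM.
- by move=> b c k u v; rewrite /T actl mulrDl scalerAl.
- by move=> a c k u v; rewrite /T mulrDl -scalerAl actl mulrDr scalerAr.
- by move=> a b k u v; rewrite /T linearP mulrDr -scalerAr actl mulrDr scalerAr.
Qed.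

Lemma invariant_mull (A : algType F) (act : H -> A -> A) c h x :
  module_algebra act -> invariant_elt act c -> act h (c * x) = c * act h x.
Proof.
move=> actA ic; have actl := act_linearl actA x.
rewrite (act_mul actA) -{2}(counitl h) (tlift_comp (f := fun k => c * act k x)).
  by apply: eq_tlift => a b; rewrite ic (linear_forZ actl) -scalerAl scalerAr.
by move=> a u v; rewrite actl mulrDr scalerAr.
Qed.

Lemma invariant_mulr (A : algType F) (act : H -> A -> A) c h x :
  module_algebra act -> invariant_elt act c -> act h (x * c) = act h x * c.
Proof.
move=> actA ic; have actl := act_linearl actA x.
rewrite (act_mul actA) -{2}(counitr h) (tlift_comp (f := fun k => act k x * c)).
  by apply: eq_tlift => a b; rewrite ic (linear_forZ actl) -scalerAl scalerAr.
by move=> a u v; rewrite actl mulrDl scalerAl.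
Qed.

Lemma tmap_pi_eq0 (I : hopf_ideal H) s :
  s \in (tensv I fullv + tensv fullv I)%VS ->
  tmap (quot_pi I) (quot_pi I) s = 0.
Proof.
have bpp : bilinear_map (fun a b => quot_pi I a ⊗ quot_pi I b).
  exact: (bilinear_comp (ptens_bilinear _ _) (quot_pi_is_linear I)
    (quot_pi_is_linear I)).
have [bl br] := ptens_bilinear (hopf_quot I) (hopf_quot I).
case/memv_addP=> u Iu [v Iv ->]; rewrite /tmap linearD /=.
have pi0 x : x \in hopf_idealv I -> quot_pi I x = 0.
  by rewrite -quot_pi_eq0 => /eqP.
rewrite (tensv_ind _ Iu) ?(tensv_ind _ Iv) ?addr0 // => x y Ix Iy /=;
  rewrite tlift_ptens //.
  by rewrite (pi0 y) // (linear_for0 (br _)).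
by rewrite (pi0 x) // (linear_for0 (bl _)).
Qed.

(** * Integrals of a semisimple Hopf algebra *)

Definition integral (t : H) : Prop :=
  [/\ counit t = 1, forall h, h * t = (counit h : F) *: t
    & forall h, t * h = (counit h : F) *: t].

(** As counit 1 = 1, the counit is nonzero on some simple summand [L i]. Its kernel there is a
    proper left ideal, hence zero, so an element [t] of [L i] with counit 1 is a left integral. *)
Lemma semisimple_integral : semisimple H -> exists t, integral t.
Proof.
case=> n [L [Lsimple _ sumL]].
have [i [x Lx ex]] : exists i, exists2 x, x \in L i & counit x != 0.
  apply: contrapT => no; suff : (1 : F) == 0 by rewrite oner_eq0.
  have : (1 : H) \in (\sum_i L i)%VS by rewrite sumL memvf.
  case/memv_sumP => v vL e1; rewrite -(counit1 (s := H)) e1 linear_sum big1 //=.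
  move=> j _; apply: contrapT => /eqP ne; apply: no; exists j.
  by exists (v j) => //; apply: vL.
have [Lid Ln0 Lmin] := Lsimple i.
have lid h y : y \in L i -> h * y \in L i.
  by move=> Ly; apply: (subvP Lid); rewrite memv_mul ?memvf.
have L0 y : y \in L i -> counit y = 0 -> y = 0.
  have lK : left_ideal (L i :&: lker (linfun (@counit F H))).
    apply/prodvP => h z _; rewrite !memv_cap => /andP[/lid-> ].
    by rewrite !memv_ker !lfunE /= counitM => /eqP->; rewrite mulr0.
  have [] := Lmin _ lK (capvSl _ _).
    move=> K0 Ly ey; apply/eqP;
      rewrite -memv0 -K0 memv_cap Ly memv_ker lfunE /=.
    exact/eqP.
  move=> KL; case/negP: ex; have := Lx; rewrite -KL memv_cap memv_ker lfunE /=.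
  by case/andP.
pose t := (counit x)^-1 *: x.
have Lt : t \in L i by apply: memvZ.
have et : counit t = 1 by rewrite linearZ /= -[_ *: _]/(_ * _) mulVf.
clearbody t.
have tl h : h * t = (counit h : F) *: t.
  apply/eqP; rewrite -subr_eq0; apply/eqP/L0.
    by rewrite memvB ?lid ?memvZ.
  by rewrite linearB linearZ /= counitM et -[_ *: _]/(_ * _) subrr.
exists t; split=> // h; apply/eqP; rewrite -subr_eq0; set u := _ - _.
(* The defect [u] of right invariance is itself a left integral, of counit 0, so [u * u = 0]; it
   remains to see that it kills every simple summand. *)
have ul g : g * u = (counit g : F) *: u.
  rewrite /u mulrBr mulrA tl -scalerAr tl scalerBr -scalerAl !scalerA.
  by rewrite [X in _ - X *: _]mulrC.
have eu : counit u = 0.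
  by rewrite linearB linearZ /= counitM et -[_ *: _]/(_ * _) mulr1 mul1r subrr.
suff uL j y : y \in L j -> u * y = 0.
  have : (1 : H) \in (\sum_i L i)%VS by rewrite sumL memvf.
  case/memv_sumP => v vL e1; rewrite -[u]mulr1 e1 mulr_sumr big1 // => j _.
  exact/uL/vL.
move=> Lj; have [Lidj _ Lminj] := Lsimple j.
have lidj g z : z \in L j -> g * z \in L j.
  by move=> Lz; apply: (subvP Lidj); rewrite memv_mul ?memvf.
have uE z : amull u z = u * z by rewrite lfunE.
have lK : left_ideal (amull u @: L j)%VS.
  apply/prodvP => g _ _ /memv_imgP[z Lz ->].
  by rewrite uE mulrA ul -scalerAl memvZ // -uE memv_img.
have lKL : (amull u @: L j <= L j)%VS.
  by apply/subvP => _ /memv_imgP[z Lz ->]; rewrite uE lidj.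
have [K0|KL] := Lminj _ lK lKL.
  by apply/eqP; rewrite -memv0 -K0 -uE memv_img.
(* Here left multiplication by [u] maps [L j] onto itself, so an element of [L j] is [u * z], and
   [u * u = 0] kills it. *)
move: Lj; rewrite -{1}KL => /memv_imgP[z Lz ->].
by rewrite uE mulrA ul eu scale0r mul0r.
Qed.

End Sweedler.

(* Nakayama: the generators of N are eliminated one at a time. *)
Lemma idempotent_space_unit (F : fieldType) (A : falgType F) (N : {vspace A}) :
  {in N &, commutative *%R} -> (N * N = N)%VS ->
  exists2 f, f \in N & forall x, x \in N -> f * x = x.
Proof.
move=> NC NN.
have NM x y : x \in N -> y \in N -> x * y \in N.
  by move=> Nx Ny; rewrite -NN memv_mul.
suff elim_gens (s : seq A) f : {subset s <= N} -> f \in N ->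
    (forall x, x \in N -> x - f * x \in (N * <<s>>)%VS) ->
    exists2 f, f \in N & forall x, x \in N -> f * x = x.
  apply: (elim_gens (vbasis N) 0) => [x|| x Nx]; first exact: vbasis_mem.
    exact: mem0v.
  by rewrite (span_basis (vbasisP N)) NN mul0r subr0.
elim: s f => [|m s IHs] f sN Nf fN.
  exists f => // x /fN; rewrite span_nil prodv0 memv0 subr_eq0.
  by move/eqP.
have Nm : m \in N by apply: sN; rewrite mem_head.
have sN' : {subset s <= N} by move=> x sx; apply: sN; rewrite in_cons sx orbT.
have split_gen y : y \in (N * <<m :: s>>)%VS ->
    exists2 a, a \in N & exists2 r, r \in (N * <<s>>)%VS & y = a * m + r.
  rewrite span_cons prodvDr => /memv_addP[u uNm [r rNs ->]].
  have /memv_imgP[a Na ->] : u \in (amulr m @: N)%VS.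
    by move: uNm; rewrite limg_amulr.
  by exists a => //; exists r => //; rewrite lfunE.
have [a Na [r rNs fm]] := split_gen _ (fN m Nm).
have Nfa : f + a \in N by apply: memvD.
have NNs y z : y \in N -> z \in (N * <<s>>)%VS -> y * z \in (N * <<s>>)%VS.
  by move=> Ny Nz; rewrite -{1}NN -prodvA memv_mul.
(* The new element is chosen so that 1 minus it equals (1 - (f + a)) (1 - f): the factor 1 - f takes
   [x] to b m + r', and 1 - (f + a) takes [m] to [r], which no longer involves the generator [m]. *)
apply: (IHs (f + ((f + a) - (f + a) * f))) => // [|x Nx].
  by rewrite memvD // memvB // NM.
have [b Nb [r' rNs' fx]] := split_gen _ (fN x Nx).
have gbm : b * ((f + a) * m) = (f + a) * (b * m) by rewrite !mulrA (NC b).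
have rE : r = m - (f + a) * m by rewrite mulrDl opprD addrA fm addrAC subrr
  add0r.
have rE' : r' = x - f * x - b * m by rewrite fx addrAC subrr add0r.
suff -> : x - (f + (f + a - (f + a) * f)) * x = b * r + (r' - (f + a) * r').
  by rewrite memvD ?memvB ?NNs.
have cancel_terms (u v y z : A) : u - v + (y - u - (z - v)) = y - z.
  by rewrite opprB addrACA [u + _]addrC subrK addKr.
rewrite rE rE' mulrBr gbm mulrBr cancel_terms.
by rewrite mulrDl mulrBl mulrBr mulrA opprD addrA.
Qed.

(** * Translations on the dual Hopf algebra *)

Section Dual.

Variables (F : fieldType) (H : hopfAlgType F).
Implicit Types (f g x y : hopf_dual H).

Lemma dual_app_is_linear (h : H) :
  linear ((fun f => dual_app f h) : hopf_dual H -> F^o).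
Proof. by move=> a f g; rewrite /dual_app add_lfunE scale_lfunE. Qed.

Lemma dual_appZ a f h : dual_app (a *: f) h = a * dual_app f h.
Proof. by rewrite /dual_app scale_lfunE. Qed.

Lemma dual_app1 h : dual_app (1 : hopf_dual H) h = counit h.
Proof. exact: dual_oneE. Qed.

Lemma dual_appM1 f g : dual_app (f * g) 1 = dual_app f 1 * dual_app g 1.
Proof.
by rewrite dual_mulE comul1 tlift_ptens //; apply: dual_mul_app_bilinear.
Qed.

(** The left regular action on the dual, which makes it a module algebra over H. *)
Definition dual_shift (h : H) f : hopf_dual H :=
  linfun (fun k => dual_app f (k * h) : F^o).

Lemma dual_shiftE h f k : dual_app (dual_shift h f) k = dual_app f (k * h).
Proof.
rewrite {1}/dual_app linfunE // => a u v.
by rewrite mulrDl -scalerAl dual_app_linear.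
Qed.

Lemma dual_shift_module_algebra : module_algebra dual_shift.
Proof.
split.
- move=> f a g h; apply: dual_appP => k.
  by rewrite dual_app_is_linear !dual_shiftE mulrDr -scalerAr dual_app_linear.
- move=> h a f g; apply: dual_appP => k.
  by rewrite dual_app_is_linear !dual_shiftE dual_app_is_linear.
- by move=> f; apply: dual_appP => k; rewrite dual_shiftE mulr1.
- by move=> g h f; apply: dual_appP => k; rewrite !dual_shiftE mulrA.
- move=> h f g; apply: dual_appP => k; rewrite dual_shiftE dual_mulE comulM.
  rewrite (tlift_comp (f := fun u => dual_app u k : F^o)); last first.
    exact: dual_app_is_linear.
  pose T a b : F^o := dual_app f a * dual_app g b.
  have bT : bilinear_map T by apply: dual_mul_app_bilinear.
  rewrite -[LHS]/(tlift T _) /tmul (linear_tlift (tlift T)) /=.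
  under [RHS]eq_tlift => a b do rewrite dual_mulE.
  rewrite -exchange_tlift; apply: (@eq_tlift F H H F^o) => a b.
  rewrite (linear_tlift (tlift T)); apply: (@eq_tlift F H H F^o) => c d /=.
  by rewrite tlift_ptens // !dual_shiftE.
- move=> h; apply: dual_appP => k; rewrite dual_shiftE dual_appZ.
  by rewrite !dual_app1 counitM mulrC.
Qed.

(** An invariant functional is [dual_app f 1] times the counit, and [t] has counit 1. *)
Lemma dual_shift_integral t f : integral t ->
  dual_app f t = 0 -> (forall h, dual_shift h f = (counit h : F) *: f) -> f = 0.
Proof.
case=> et _ _ ft fi; apply: dual_appP => h.
have f1 h' : dual_app f h' = counit h' * dual_app f 1.
  by rewrite -dual_appZ -fi dual_shiftE mul1r.
by move: ft; rewrite f1 et mul1r => f10; rewrite f1 f10 mulr0 /dual_app lfunE.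
Qed.

(** Induction on [\dim N]. If [N * N] is smaller, it inherits the hypotheses and contains x x, and
    evaluation at 1 is multiplicative. Otherwise [N] has a unit, which turns out to be zero. *)
Lemma shift_stable_eval0 t (N : {vspace hopf_dual H}) : integral t ->
  {in N &, commutative *%R} -> (N * N <= N)%VS ->
  (forall h x, x \in N -> dual_shift h x \in N) ->
  (forall x, x \in N -> dual_app x t = 0) ->
  forall x, x \in N -> dual_app x 1 = 0.
Proof.
move=> tI; have [k] := ubnP (\dim N);
  elim: k N => // k IHk N leNk NC NN Nst Nt x Nx.
have [eqNN|ltNN] := eqVneq (N * N)%VS N; last first.
  have dimNN : (\dim (N * N) < k)%N.
    apply: leq_trans (_ : \dim N <= k)%N => //.
    rewrite ltn_neqAle dimvS // andbT; apply: contraNneq ltNN => eqd.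
    by rewrite eqEdim NN eqd /=.
  have sNN y : y \in (N * N)%VS -> y \in N by apply: subvP NN y.
  have := IHk _ dimNN _ _ _ _ (x * x); rewrite dual_appM1 => x2.
  apply/eqP; rewrite -sqrf_eq0 expr2; apply/eqP/x2; last exact: memv_mul.
  - by move=> y z /sNN Ny /sNN Nz; apply: NC.
  - by apply/prodvP => y z /sNN Ny /sNN Nz; apply: memv_mul.
  - move=> h; suff : (N * N <= linfun (dual_shift h) @^-1: (N * N))%VS.
      by move=> s y /(subvP s); rewrite -memv_preim linfunE //;
        apply: (act_linearr dual_shift_module_algebra).
    apply/prodvP => y z Ny Nz; rewrite -memv_preim linfunE; last first.
      exact: (act_linearr dual_shift_module_algebra).
    rewrite (act_mul dual_shift_module_algebra); apply: memv_tlift => a b.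
    by apply: memv_mul; apply: Nst.
  - by move=> y /sNN; apply: Nt.
have [f Nf fN] := idempotent_space_unit NC eqNN.
suff f0 : f = 0 by rewrite -(fN x Nx) f0 mul0r /dual_app lfunE.
apply: (dual_shift_integral tI); first exact: Nt.
(* The unit is invariant: (h . f) f is the sum of h1 . (f (S(h2) . f)); the unit absorbs the inner
   product, and h1 S(h2) contracts to the counit. *)
move=> h; rewrite -[LHS]fN; last exact: Nst.
rewrite NC ?Nst // (module_algebra_mulC dual_shift_module_algebra).
transitivity (tlift (fun a b => dual_shift (a * antipode b) f) (comul h)).
  apply: eq_tlift => a b.
  by rewrite fN ?Nst // (act_comp dual_shift_module_algebra).
have lin := act_linearl dual_shift_module_algebra f.
rewrite -(tlift_comp (f := fun k => dual_shift k f)) // antipoder.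
by rewrite (linear_forZ lin) (act_id dual_shift_module_algebra).
Qed.

End Dual.

(** * Places with values in an algebraically closed field *)

Section Places.

Variables (F : closedFieldType) (Z : comUnitAlgType F).
Implicit Types (G : Z -> F -> Prop) (p : {poly Z}) (q : {poly F}).

(* The graph of an F-algebra morphism from a subalgebra of Z to F. *)
Record partial_point G : Prop := PartialPoint {
  point_scalar : forall a, G a%:A a;
  point_add : forall x y a b, G x a -> G y b -> G (x + y) (a + b);
  point_mul : forall x y a b, G x a -> G y b -> G (x * y) (a * b);
  point_fun : forall a, G 0 a -> a = 0;
}.

Definition coef_rel G p q := forall i, G p`_i q`_i.

Section Extension.

Variables (G : Z -> F -> Prop) (Gpt : partial_point G).

Lemma point0 : G 0 0.
Proof. by have := point_scalar Gpt 0; rewrite scale0r. Qed.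

Lemma point1 : G 1 1.
Proof. by have := point_scalar Gpt 1; rewrite scale1r. Qed.

Lemma point_scale c x a : G x a -> G (c *: x) (c * a).
Proof. by move=> Gxa; rewrite -mulr_algl; apply: point_mul => //;
  apply: point_scalar. Qed.

Lemma point_sum I (r : seq I) (P : pred I) (f : I -> Z) (g : I -> F) :
  (forall i, P i -> G (f i) (g i)) ->
    G (\sum_(i <- r | P i) f i) (\sum_(i <- r | P i) g i).
Proof.
by move=> fg; elim/big_ind2: _ => // [|x a y b];
  [apply: point0 | apply: point_add].
Qed.

Lemma point_tlift (U V : vectType F) (B : U -> V -> Z) (B' : U -> V -> F^o) s :
  (forall u v, G (B u v) (B' u v)) -> G (tlift B s) (tlift B' s).
Proof.
move=> BB'; apply: point_sum => i _; apply: point_sum => j _.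
exact: point_scale.
Qed.

Lemma point_inj x a b : G x a -> G x b -> a = b.
Proof.
move=> Ga Gb; apply/eqP; rewrite -subr_eq0; apply/eqP/(point_fun Gpt).
rewrite -(subrr x) -scaleN1r -[- b]mulN1r.
by apply: point_add => //; apply: point_scale.
Qed.

Lemma coef_relC x a : G x a -> coef_rel G x%:P a%:P.
Proof. by move=> Gxa i; rewrite !coefC; case: eqP => // _; apply: point0. Qed.

Lemma coef_relX : coef_rel G 'X 'X.
Proof.
move=> i; rewrite !coefX.
by have := point_scalar Gpt (i == 1%N)%:R; rewrite scaler_nat.
Qed.

Lemma coef_relD p p' q q' :
  coef_rel G p q -> coef_rel G p' q' -> coef_rel G (p + p') (q + q').
Proof. by move=> pq pq' i; rewrite !coefD; apply: point_add. Qed.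

Lemma coef_relM p p' q q' :
  coef_rel G p q -> coef_rel G p' q' -> coef_rel G (p * p') (q * q').
Proof.
move=> pq pq' i; rewrite !coefM; apply: point_sum => j _.
exact: point_mul.
Qed.

Lemma coef_relN p q : coef_rel G p q -> coef_rel G (- p) (- q).
Proof.
move=> pq i; rewrite !coefN -scaleN1r -[- q`_i]mulN1r.
exact: point_scale.
Qed.

Lemma coef_relXn n : coef_rel G 'X^n 'X^n.
Proof.
elim: n => [|n IHn]; first by rewrite !expr0; apply/coef_relC/point1.
by rewrite !exprS; apply: coef_relM => //; apply: coef_relX.
Qed.

Lemma coef_rel_map q : coef_rel G (map_poly (in_alg Z) q) q.
Proof. by move=> i; rewrite coef_map; apply: point_scalar. Qed.

(** The subalgebra generated by [x], with [x] sent to [xi]. As a relation this always makes sense;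
    only single-valuedness, that is [point_fun], can fail. *)
Definition extend_point x xi z a :=
  exists p q, [/\ coef_rel G p q, p.[x] = z & q.[xi] = a].

Lemma extend_point_sub x xi z a : G z a -> extend_point x xi z a.
Proof.
by move=> Gza; exists z%:P, a%:P; rewrite !hornerC; split=> //;
  apply: coef_relC.
Qed.

Lemma extend_point_gen x xi : extend_point x xi x xi.
Proof. by exists 'X, 'X; rewrite !hornerX; split=> //; apply: coef_relX. Qed.

Lemma extend_pointP x xi :
  (forall p q, coef_rel G p q -> p.[x] = 0 -> q.[xi] = 0) ->
  partial_point (extend_point x xi).
Proof.
move=> fun0; split=> [a|y z a b|y z a b|a].
- exact/extend_point_sub/(point_scalar Gpt).
- case=> p [q [pq <- <-]] [p' [q' [pq' <- <-]]]; exists (p + p'), (q + q').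
  by rewrite !hornerD; split=> //; apply: coef_relD.
- case=> p [q [pq <- <-]] [p' [q' [pq' <- <-]]]; exists (p * p'), (q * q').
  by rewrite !hornerM; split=> //; apply: coef_relM.
- by case=> p [q [pq p0 <-]]; apply: fun0 p0.
Qed.

(* If no value can be given to x, the images q of the relations p.[x] = 0 form
   an ideal of F[X] without a common root, hence the unit ideal. *)
Lemma not_extend_point x :
  (forall xi, ~ partial_point (extend_point x xi)) ->
  exists2 p, coef_rel G p 1 & p.[x] = 0.
Proof.
move=> noext.
pose I q := exists2 p, coef_rel G p q & p.[x] = 0.
have noroot xi : exists2 q, I q & q.[xi] != 0.
  apply: contrapT => no; apply: (noext xi); apply: extend_pointP => p q pq p0.
  by apply: contrapT => /eqP q0; apply: no; exists q => //; exists p.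
have [q0 Iq0 q0n] : exists2 q, I q & q != 0.
  by have [q Iq q0] := noroot 0; exists q => //; apply: contraNneq q0 => ->;
    rewrite horner0.
have [q [Iq qn qmin]] : exists q, [/\ I q, q != 0 & forall r, I r -> r != 0 ->
  (size q <= size r)%N].
  have [k] := ubnP (size q0); elim: k q0 Iq0 q0n => // k IHk q Iq qn szq.
  have [[r [Ir rn ltr]]|no] :=
    pselect (exists r, [/\ I r, r != 0 & (size r < size q)%N]).
    by apply: (IHk r) => //; apply: leq_trans ltr _.
  exists q; split=> // r Ir rn; rewrite leqNgt; apply/negP => ltr.
  by apply: no; exists r.
have IM r s : I s -> I (r * s).
  case=> p ps p0; exists (map_poly (in_alg Z) r * p).
    by apply: coef_relM => //; apply: coef_rel_map.
  by rewrite hornerM p0 mulr0.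
have IB r s : I r -> I s -> I (r - s).
  case=> p pr p0 [p' ps p0']; exists (p - p').
    by apply: coef_relD => //; apply: coef_relN.
  by rewrite hornerD hornerN p0 p0' subr0.
have qdiv r : I r -> (q %| r)%R.
  move=> Ir; apply/modp_eq0P/eqP; apply: contraT => rn.
  have : (size q <= size (r %% q)%R)%N.
    apply: qmin => //.
    have -> : (r %% q)%R = r - (r %/ q)%R * q.
      by apply/eqP; rewrite eq_sym subr_eq addrC -divp_eq.
    exact/IB/IM.
  by rewrite leqNgt ltn_modp qn.
have /eqP sz1 : size q == 1%N.
  apply/negPn/negP => /closed_rootP[xi rxi].
  have [r /qdiv/dvdpP[s ->]] := noroot xi.
  by rewrite hornerM (rootP rxi) mulr0 eqxx.
have [c cn qE] : exists2 c, c != 0 & q = c%:P.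
  by apply/size_poly1P; rewrite sz1.
have [p pq p0] : I 1.
  by have := IM (c^-1)%:P _ Iq; rewrite qE -polyCM mulVf.
by exists p.
Qed.

(** The extension step for places. If both fail, [x] and [x^-1] are roots of polynomials that reduce
    to 1. Each of these has positive degree, yet the longer can always be shortened by means of the
    other, which cannot go on forever. *)
Lemma extend_point_or x : x \is a GRing.unit ->
  exists xi, partial_point (extend_point x xi) \/ partial_point (extend_point
    x^-1 xi).
Proof.
move=> xU; apply: contrapT => no.
have [p p1 px] :=
  not_extend_point (fun xi e => no (ex_intro _ xi (or_introl e))).
have [p' p1' px'] :=
  not_extend_point (fun xi e => no (ex_intro _ xi (or_intror e))).
have {no} [n] := ubnP (size p + size p').
elim: n x xU p p' p1 px p1' px' => // n IHn x xU p p' p1 px p1' px'.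
wlog szpp : x xU p p' p1 px p1' px' / (size p' <= size p)%N.
  move=> hw; have [|/ltnW] := leqP (size p') (size p); first exact: (hw x).
  move=> szpp szn; apply: (hw x^-1 _ p' p) => //; rewrite ?unitrV ?invrK //.
  by rewrite addnC.
move=> szn.
have size_gt1 r y : coef_rel G r 1 -> r.[y] = 0 -> (1 < size r)%N.
  move=> r1 ry; rewrite ltnNge; apply/negP => /size1_polyC rE.
  move: ry; rewrite rE hornerC => r0.
  have := r1 0; rewrite r0 coefC /= => /(point_fun Gpt)/eqP.
  by rewrite oner_eq0.
have sp := size_gt1 _ _ p1 px; have sp' := size_gt1 _ _ p1' px'.
have [k pk] : exists k, size p = k.+2 by exists (size p).-2;
  case: (size p) sp => [|[]].
have [l p'l] : exists l, size p' = l.+2 by exists (size p').-2;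
  case: (size p') sp' => [|[]].
have lk : (l <= k)%N by move: szpp; rewrite pk p'l.
(* The reversal of [p']: it vanishes at [x] and reduces to a power of X instead of 1. *)
pose r := \poly_(j < l.+2) p'`_(l.+1 - j).
have rel_r : coef_rel G r 'X^(l.+1).
  move=> j; rewrite coef_poly coefXn ltnS; case: leqP => [lej|ltj].
    by have := p1' (l.+1 - j)%N; rewrite coef1 subn_eq0 eqn_leq lej.
  by rewrite gtn_eqF //; apply: point0.
have rx : r.[x] = 0.
  transitivity (x ^+ l.+1 * p'.[x^-1]); last by rewrite px' mulr0.
  rewrite horner_poly horner_coef p'l mulr_sumr (reindex_inj rev_ord_inj) /=.
  apply: eq_bigr => j _; have lej : (j <= l.+1)%N by rewrite -ltnS.
  rewrite subSS subKn // mulrCA; congr (_ * _).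
  by rewrite exprB // exprVn.
(* The coefficients of X^(k+1) cancel. The reduction is still 1, since [p'_0] reduces to 1 and the
   leading coefficient of [p], being of positive index, reduces to 0. *)
pose p2 := (p'`_0)%:P * p - (p`_k.+1)%:P * ('X^(k - l) * r).
have rel2 : coef_rel G p2 1.
  have -> : 1 = 1%:P * 1 - 0%:P * ('X^(k - l) * 'X^(l.+1)) :> {poly F}.
    by rewrite mul0r subr0 mulr1.
  have p0 := p1' 0; rewrite coef1 /= in p0; have pn := p1 k.+1;
    rewrite coef1 /= in pn.
  apply: coef_relD; first exact: coef_relM (coef_relC p0) p1.
  apply: coef_relN; apply: coef_relM (coef_relC pn) _.
  exact: coef_relM (coef_relXn _) rel_r.
have p2x : p2.[x] = 0.
  by rewrite hornerD hornerN !hornerM px rx !mulr0 subr0.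
apply: (IHn x xU p2 p' rel2 p2x p1' px').
suff : (size p2 < size p)%N.
  by move=> lt2; rewrite -ltnS; apply: leq_trans szn;
    rewrite ltnS -addSn leq_add2r.
rewrite pk ltnS; apply/leq_sizeP => j lej.
have -> : p2`_j = p'`_0 * p`_j - p`_k.+1 * r`_(j - (k - l)).
  rewrite coefB !coefCM coefXnM.
  by have -> : (j < k - l)%N = false by lia.
rewrite coef_poly; have [->|nej] := eqVneq j k.+1.
  have -> : (k.+1 - (k - l) < l.+2)%N by lia.
  have -> : (l.+1 - (k.+1 - (k - l)) = 0)%N by lia.
  by rewrite mulrC subrr.
have -> : (j - (k - l) < l.+2)%N = false by lia.
have -> : p`_j = 0 by apply: nth_default; rewrite pk; lia.
by rewrite !mulr0 subr0.
Qed.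

End Extension.
Hypothesis divZ : division_ring Z.

(** Over an algebraically closed field [q] splits into linear factors, and one of them must vanish
    at [y] in a division algebra. *)
Lemma algebraic_scalar q y :
  q != 0 -> (map_poly (in_alg Z) q).[y] = 0 -> exists a, y = a%:A.
Proof.
have [n] := ubnP (size q); elim: n q => // n IHn q szq qn qy.
have [/eqP/size_poly1P[c cn qE]|/closed_rootP[xi /factor_theorem[r qE]]] :=
  eqVneq (size q) 1%N.
  move: qy; rewrite qE map_polyC hornerC /= => /eqP.
  by rewrite scaler_eq0 oner_eq0 orbF (negPf cn).
have rn : r != 0 by apply: contraNneq qn => r0; rewrite qE r0 mul0r.
move: qy; rewrite qE rmorphM hornerM /= rmorphB /= map_polyX map_polyC
  hornerXsubC /=.
have [|yn] := eqVneq (y - xi%:A) 0; first by move/subr0_eq => ->; exists xi.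
move/(congr1 (fun z => z / (y - xi%:A))); rewrite mulrK ?divZ // mul0r.
apply: IHn => //; move: szq; rewrite qE size_Mmonic ?monicXsubC // size_XsubC.
by rewrite addn2.
Qed.

(** Deciding the finitely many elements of [s] takes the place of a full valuation ring. *)
Lemma total_point_extend (s : seq Z) G : partial_point G ->
  {in s, forall x, x != 0} ->
  exists G', [/\ partial_point G', forall z a, G z a -> G' z a
    & {in s, forall x, exists a, G' x a \/ G' x^-1 a}].
Proof.
elim: s G => [|x s IHs] G Gpt sn; first by exists G.
have [|xi ext] := @extend_point_or G Gpt x; first by apply/divZ/sn/mem_head.
have [G1 [G1pt GG1 G1x]] :
  exists G1, [/\ partial_point G1, forall z a, G z a -> G1 z a
    & exists a, G1 x a \/ G1 x^-1 a].
  case: ext => ext.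
    exists (extend_point G x xi); apply: And3 => // [z a|].
      exact: extend_point_sub.
    by exists xi; left; apply: extend_point_gen.
  exists (extend_point G x^-1 xi); apply: And3 => // [z a|].
    exact: extend_point_sub.
  by exists xi; right; apply: extend_point_gen.
have [|G' [G'pt GG' G's]] := IHs G1 G1pt.
  by move=> y sy; apply: sn; rewrite in_cons sy orbT.
exists G'; split=> // [z a /GG1/GG'//|y]; rewrite in_cons => /predU1P[->|ys];
  last exact: G's.
by case: G1x => a [/GG'|/GG'] ?; exists a; [left|right].
Qed.

Lemma exists_max_total (T : eqType) (R : T -> T -> Prop) (s : seq T) x0 :
  x0 \in s -> {in s &, forall x y, R x y \/ R y x} ->
  {in s, forall y x z, R x y -> R y z -> R x z} ->
  exists2 x, x \in s & {in s, forall y, R y x}.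
Proof.
move=> x0s Rtot Rtr; elim: s x0 x0s Rtot Rtr => // x s IHs _ _ Rtot Rtr.
have Rxx : R x x by case: (Rtot x x (mem_head _ _) (mem_head _ _)).
case: s => [|y s] in IHs Rtot Rtr *.
  by exists x => [|z]; rewrite !inE // => /eqP->.
have [||z sz zmax] := IHs y (mem_head _ _).
- by move=> u v us vs; apply: Rtot; rewrite in_cons ?us ?vs orbT.
- by move=> u us; apply: Rtr; rewrite in_cons us orbT.
have sz' : z \in x :: y :: s by rewrite in_cons sz orbT.
have [Rxz|Rzx] := Rtot x z (mem_head _ _) sz'.
  by exists z => // u; rewrite in_cons => /predU1P[->|us] //; apply: zmax.
exists x => [|u]; first exact: mem_head.
by rewrite in_cons => /predU1P[->//|us]; apply: Rtr (zmax u us) Rzx.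
Qed.

(* v0 has the worst pole among the elements of s, at a place where c has one. *)
Lemma exists_pole (s : seq Z) c : c \in s -> (forall a, c <> a%:A) ->
  exists (G : Z -> F -> Prop) v0, [/\ partial_point G, v0 \in s, v0 != 0,
    {in s, forall v, exists a, G (v / v0) a} & G v0^-1 0].
Proof.
move=> cs cF.
have cn : c != 0 by apply/eqP => c0; apply: (cF 0); rewrite scale0r.
have scalar_pt : partial_point (fun z a => z = a%:A).
  split=> [//|_ _ a b -> ->|_ _ a b -> ->|a].
  - by rewrite scalerDl.
  - by rewrite -scalerAl mul1r scalerA.
  - move/esym/eqP; rewrite scaler_eq0 oner_eq0 orbF; exact/eqP.
(* Sending [c^-1] to 0 is consistent: a nonscalar [c] has a transcendental inverse, so only the zero
   polynomial gives a relation. *)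
have c0pt : partial_point (extend_point (fun z a => z = a%:A) c^-1 0).
  apply: (extend_pointP scalar_pt) => p q pq pc.
  have [->|qn] := eqVneq q 0; first by rewrite horner0.
  have pE : p = map_poly (in_alg Z) q by apply/polyP => i; rewrite coef_map pq.
  have [|a ca] := algebraic_scalar qn (y := c^-1); first by rewrite -pE.
  have an : a != 0.
    by apply: contraNneq cn => a0; rewrite -invr_eq0 ca a0 scale0r.
  by case: (cF a^-1); rewrite -[LHS]invrK ca invrZ ?unitr1 ?unitfE // invr1.
pose s1 := [seq x <- 1 :: s | x != 0].
have s1n x : x \in s1 -> x != 0 by rewrite mem_filter => /andP[].
have [|G [Gpt G0 Gs]] :=
  @total_point_extend [seq x / y | x <- s1, y <- s1] _ c0pt.
  move=> _ /allpairsP[[x y] /= [/s1n xn /s1n yn ->]].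
  by apply: contraNneq xn => xy; rewrite -(divrK (divZ yn) x) xy mul0r.
have [||y ys x z [a xy] [b yz]|v0 v0s v0max] :=
  @exists_max_total _ (fun x y => exists a, G (x / y) a) s1 1.
- by rewrite mem_filter oner_eq0 mem_head.
- move=> x y xs ys; have [|a [Ga|Ga]] := Gs (x / y); first by apply/allpairsP;
    exists (x, y).
    by left; exists a.
  right; exists a; rewrite (_ : y / x = (x / y)^-1) //.
  by rewrite invrM ?unitrV ?invrK //; apply: divZ; apply: s1n.
- exists (a * b); rewrite (_ : x / z = x / y * (y / z)); first exact: point_mul.
  by rewrite mulrA divrK //; apply/divZ/s1n.
have v1s v : v \in s -> exists a, G (v / v0) a.
  have [-> _|vn vs] := eqVneq v 0; last by apply: v0max;
    rewrite mem_filter vn in_cons vs orbT.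
  by exists 0; rewrite mul0r; apply: point0.
have v0n : v0 != 0 := s1n _ v0s.
have Gv0 : G v0^-1 0.
  have [a Ga] := v1s c cs.
  rewrite (_ : v0^-1 = c / v0 * c^-1);
    last by rewrite mulrAC divrr ?divZ // mul1r.
  rewrite -(mulr0 a); apply: (point_mul Gpt) => //; apply: G0.
  exact: extend_point_gen.
exists G, v0; split=> //.
(* The adjoined element 1 cannot be the maximum, since then 1 would specialise to 0. *)
move: v0s; rewrite mem_filter in_cons => /andP[_ /predU1P[v01|//]].
move: Gv0; rewrite v01 invr1 => /(point_inj Gpt (point1 Gpt))/eqP.
by rewrite oner_eq0.
Qed.

End Places.

(** * The integral form on a field and its Casimir element *)

Section FieldAction.

Variables (F : fieldType) (H : hopfAlgType F) (Z : comUnitAlgType F).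
Variables (act : H -> Z -> Z) (t : H).
Hypotheses (divZ : division_ring Z) (actZ : module_algebra act) (tI :
  integral t).

Let actl := act_linearl actZ.
Let actr := act_linearr actZ.

Lemma integral_invariant x : invariant_elt act (act t x).
Proof.
case: tI => _ ht _ h; rewrite -(act_comp actZ) ht.
exact: (linear_forZ (actl x)).
Qed.

Lemma integral_act h x : act t (act h x) = (counit h : F) *: act t x.
Proof.
case: tI => _ _ th; rewrite -(act_comp actZ) th.
exact: (linear_forZ (actl x)).
Qed.

Lemma integral_act1 : act t 1 = 1.
Proof. by case: tI => et _ _; rewrite (act_one actZ) et scale1r. Qed.

Lemma integral_form_nondeg y : (forall z, act t (z * y) = 0) -> y = 0.
Proof.
move=> y0; apply: contrapT => /eqP/divZ yU.
by have /eqP := y0 y^-1; rewrite mulVr // integral_act1 oner_eq0.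
Qed.

(** By [module_algebra_mulC] the left side is the sum of t g1 . (x (S(g2) . y)), and [t] absorbs
    g1. *)
Lemma integral_form_adj g x y :
  act t (act g x * y) = act t (x * act (antipode g) y).
Proof.
rewrite (module_algebra_mulC actZ) (tlift_comp (f := act t)) //.
rewrite -{2}(counitl g) linear_tlift.
rewrite (tlift_comp (f := fun k => act t (x * act k y))).
  by apply: eq_tlift => a b; rewrite integral_act linearZ (linear_forZ (actl y))
    -scalerAr (linear_forZ (actr t)).
by move=> c u v; rewrite actl mulrDr -scalerAr actr.
Qed.

(** Expanding [comul t] in a basis of H factors the Gram matrix, here the identity of size n,
    through a space of dimension [\dim {:H}]. *)
Lemma integral_form_system_size n (a a' : 'I_n -> Z) :
  (forall i j, act t (a' i * a j) = (i == j)%:R) -> (n <= \dim {:H})%N.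
Proof.
move=> orth.
pose A := \matrix_(i < n, k < \dim {:H}) act (vbasis {:H})`_k (a' i).
pose B := \matrix_(k < \dim {:H}, j < n)
  \sum_l comul t k l *: act (vbasis {:H})`_l (a j).
apply: (mulmx1_min (A := A) (B := B)); apply/matrixP => i j; rewrite !mxE -orth.
rewrite (act_mul actZ); apply: eq_bigr => k _; rewrite !mxE mulr_sumr.
by apply: eq_bigr => l _; rewrite scalerAr.
Qed.

(** Biorthogonal systems have bounded length, and a system that fails to reproduce some [x] can be
    lengthened by the remainder [y]. *)
Lemma integral_form_dual_bases :
  exists n (a a' : 'I_n -> Z), forall x, x = \sum_i a i * act t (a' i * x).
Proof.
apply: contrapT => no.
suff ext n : exists a a' : 'I_n ->
  Z, forall i j, act t (a' i * a j) = (i == j)%:R.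
  have [a [a' orth]] := ext (\dim {:H}).+1.
  by have := integral_form_system_size orth; rewrite ltnn.
elim: n => [|n [a [a' orth]]]; first by exists (fun=> 0), (fun=> 0) => -[].
have [x xn] : exists x, x - \sum_i a i * act t (a' i * x) != 0.
  apply: contrapT => nox; apply: no; exists n, a, a' => x.
  by apply/eqP; rewrite -subr_eq0; apply: contrapT => /negP xn; apply: nox;
    exists x.
set y := _ - _ in xn.
have a'y j : act t (a' j * y) = 0.
  rewrite mulrBr (linear_forB (actr t)) mulr_sumr (linear_for_sum (actr t)).
  rewrite (bigD1 j) //= big1 => [|i ij].
    rewrite addr0 mulrA (invariant_mulr _ _ actZ (integral_invariant _)).
    by rewrite orth eqxx mul1r subrr.
  rewrite mulrA (invariant_mulr _ _ actZ (integral_invariant _)).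
  by rewrite orth eq_sym (negPf ij) mul0r.
(* The inverse of [y] pairs with [y] to 1. Making it orthogonal to the [a j] keeps this value
   because [y] is orthogonal to the [a' j]. *)
pose y' := y^-1 - \sum_j act t (y^-1 * a j) * a' j.
have y'a k : act t (y' * a k) = 0.
  rewrite mulrBl (linear_forB (actr t)) mulr_suml (linear_for_sum (actr t)).
  rewrite (bigD1 k) //= big1 => [|i ij].
    rewrite addr0 -mulrA (invariant_mull _ _ actZ (integral_invariant _)).
    by rewrite orth eqxx mulr1 subrr.
  rewrite -mulrA (invariant_mull _ _ actZ (integral_invariant _)).
  by rewrite orth (negPf ij) mulr0.
have y'y : act t (y' * y) = 1.
  rewrite mulrBl (linear_forB (actr t)) mulr_suml (linear_for_sum (actr t)).
  rewrite big1 => [|i _]; last first.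
    rewrite -mulrA (invariant_mull _ _ actZ (integral_invariant _)).
    by rewrite a'y mulr0.
  by rewrite subr0 mulVr ?divZ // integral_act1.
exists (fun j => oapp a y (unlift ord0 j)), (fun j =>
  oapp a' y' (unlift ord0 j)).
move=> i j; case: (unliftP ord0 i) => [i'|] ->;
  case: (unliftP ord0 j) => [j'|] ->;
  by rewrite ?liftK ?unlift_none /= ?y'y ?y'a ?a'y ?orth ?(inj_eq lift_inj)
    ?eqxx // (negPf (neq_lift _ _)) || rewrite eq_sym (negPf (neq_lift _ _)).
Qed.

Section DualBases.

Variables (n : nat) (a a' : 'I_n -> Z).
Hypothesis dual_a : forall x, x = \sum_i a i * act t (a' i * x).

Lemma dual_bases_sym x : x = \sum_i a' i * act t (a i * x).
Proof.
apply/eqP; rewrite -subr_eq0; apply/eqP/integral_form_nondeg => z.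
rewrite mulrBr (linear_forB (actr t)) [in z * x](dual_a z) mulr_suml mulr_sumr.
rewrite !(linear_for_sum (actr t)) -sumrB big1 // => i _.
rewrite [_ * act t _ * x]mulrAC [X in X - _](invariant_mulr _ _ actZ
  (integral_invariant _)).
rewrite [z * _]mulrA (invariant_mulr _ _ actZ (integral_invariant _)).
by rewrite [z * a' i]mulrC [X in X - _]mulrC subrr.
Qed.

(* The element of Z (x) H^* attached to the Casimir element of Z over Z^H. *)
Definition casimir (h : H) : Z := \sum_i a i * act h (a' i).

Lemma casimir_linear : linear casimir.
Proof.
move=> c u v; rewrite /casimir scaler_sumr -big_split; apply: eq_bigr => i _.
by rewrite actl mulrDr scalerAr.
Qed.

Lemma casimir_integral : casimir t = 1.
Proof. by rewrite [RHS]dual_a; apply: eq_bigr => i _; rewrite mulr1. Qed.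

(** Over the invariants, the Casimir element can absorb [x] in either factor: expand a'_i x in the
    family a' and resum over i. *)
Lemma casimir_mul h x : \sum_i a i * act h (a' i * x) = x * casimir h.
Proof.
transitivity (\sum_i \sum_j (a i * act t (a' i * (a j * x))) * act h (a' j)).
  apply: eq_bigr => i _; rewrite [in LHS](dual_bases_sym (a' i * x)).
  rewrite (linear_for_sum (actr h)) mulr_sumr; apply: eq_bigr => j _.
  rewrite (invariant_mulr _ _ actZ (integral_invariant _)) -mulrA.
  by rewrite [act h _ * _]mulrC [a j * (_ * _)]mulrCA.
rewrite exchange_big mulr_sumr; apply: eq_bigr => j _.
by rewrite -mulr_suml -dual_a mulrA [x * _]mulrC.
Qed.

(** The action is recovered from [casimir]. Insert 1 as the sum of a_i (t . a'_i), then apply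
    [module_algebra_mulC] to (t . a'_i) x and [casimir_mul]. *)
Lemma casimir_act h x :
  act h x = tlift (fun u v => casimir (h * u) * act (antipode v) x) (comul t).
Proof.
transitivity (\sum_i a i * act h (act t (a' i) * x)).
  under eq_bigr => i _ do
    rewrite (invariant_mull _ _ actZ (integral_invariant _)) mulrA.
  by rewrite -mulr_suml -[\sum_i _]/(casimir t) casimir_integral mul1r.
transitivity (\sum_i tlift (fun u v =>
    a i * act (h * u) (a' i * act (antipode v) x)) (comul t)).
  apply: eq_bigr => i _; rewrite (module_algebra_mulC actZ).
  rewrite (tlift_comp (f := fun z => a i * act h z)).
    by apply: eq_tlift => u v; rewrite (act_comp actZ).
  by move=> c u v; rewrite actr mulrDr scalerAr.
rewrite tlift_sum; apply: eq_tlift => u v.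
by rewrite casimir_mul mulrC.
Qed.

(** Expand S(g) . b in the dual bases and move S(g) across the integral form by
    [integral_form_adj]. *)
Lemma casimir_shift_act g b :
  tlift (fun u v => casimir (u * g) * act v b) (comul t) = act (antipode g) b.
Proof.
transitivity (\sum_i tlift (fun u v =>
  a i * (act (u * g) (a' i) * act v b)) (comul t)).
  rewrite tlift_sum; apply: eq_tlift => u v; rewrite mulr_suml.
  by apply: eq_bigr => i _; rewrite mulrA.
rewrite [RHS]dual_a; apply: eq_bigr => i _.
rewrite -integral_form_adj (act_mul actZ) (tlift_comp (f := fun z => a i * z)).
  by apply: eq_tlift => u v; rewrite (act_comp actZ).
by move=> c u v; rewrite mulrDr scalerAr.
Qed.

End DualBases.

End FieldAction.

(** * The Casimir map has scalar values *)

Section CasimirScalar.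

Variables (F : closedFieldType) (H : hopfAlgType F) (Z : comUnitAlgType F).
Variables (act : H -> Z -> Z) (t : H).
Hypotheses (divZ : division_ring Z) (actZ : module_algebra act) (tI :
  integral t).
Variables (n : nat) (a a' : 'I_n -> Z).
Hypothesis dual_a : forall x, x = \sum_i a i * act t (a' i * x).

Let actl := act_linearl actZ.
Let actr := act_linearr actZ.
Let w := casimir act a a'.

(* The image of \sum z (x) b under the map Z (x) Z -> Z (x) H^* given by the
   coaction on the second factor;
     [casimir] and its translates have this form. *)
Definition orbit_map (s : seq (Z * Z)) (h : H) : Z :=
  \sum_(p <- s) p.1 * act h p.2.

Definition orbit_mul (s s' : seq (Z * Z)) :=
  [seq (p.1 * q.1, p.2 * q.2) | p <- s, q <- s'].

Lemma orbit_mapM s s' h :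
  orbit_map (orbit_mul s s') h
    = tlift (fun u v => orbit_map s u * orbit_map s' v) (comul h).
Proof.
rewrite /orbit_map big_allpairs_dep.
transitivity (\sum_(p <- s) \sum_(q <- s') tlift (fun u v =>
    (p.1 * act u p.2) * (q.1 * act v q.2)) (comul h)).
  apply: eq_bigr => p _; apply: eq_bigr => q _ /=.
  rewrite (act_mul actZ) (tlift_comp (f := fun z => p.1 * q.1 * z)).
    by apply: eq_tlift => u v; rewrite mulrACA.
  by move=> c u v; rewrite mulrDr scalerAr.
under eq_bigr => p _ do rewrite tlift_sum.
rewrite tlift_sum; apply: eq_tlift => u v; rewrite mulr_suml.
by apply: eq_bigr => p _; rewrite mulr_sumr.
Qed.

(** Commutativity of Z in both factors; this makes translates of the Casimir map commute under
    convolution and is the source of cocommutativity. *)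
Lemma orbit_mapC s s' h :
  orbit_map (orbit_mul s s') h = orbit_map (orbit_mul s' s) h.
Proof.
rewrite /orbit_map !big_allpairs_dep exchange_big /=.
apply: eq_bigr => q _; apply: eq_bigr => p _ /=.
by rewrite [p.1 * _]mulrC [p.2 * _]mulrC.
Qed.

(** The right side contains no value of [w], so after division by a pole [v0] it specialises to 0
    whenever the orbit map of [s] specialises. *)
Lemma casimir_shift_orbit g s :
  tlift (fun u v => w (u * g) * orbit_map s v) (comul t)
    = orbit_map s (antipode g).
Proof.
transitivity (\sum_(p <- s) tlift (fun u v =>
    p.1 * (w (u * g) * act v p.2)) (comul t)).
  rewrite tlift_sum; apply: eq_tlift => u v; rewrite mulr_sumr.
  by apply: eq_bigr => p _; rewrite mulrCA.
apply: eq_bigr => p _; rewrite -(casimir_shift_act actZ tI dual_a).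
by rewrite (tlift_comp (f := fun z => p.1 * z)) // => c u v;
  rewrite mulrDr scalerAr.
Qed.

Lemma casimir_scalar h : exists c, w h = c%:A.
Proof.
have wl : linear w := casimir_linear actZ a a'.
apply: contrapT => wh.
pose b := vbasis {:H}.
have bE k : k = \sum_i coord b i k *: b`_i := coord_vbasis (memvf k).
have [i0 wi0] : exists i0 : 'I_(\dim {:H}), forall c, w b`_i0 <> c%:A.
  apply: contrapT => no.
  have /choice[c wc] : forall i : 'I_(\dim {:H}), exists c, w b`_i = c%:A.
    by move=> i; apply: contrapT => wi; apply: no; exists i => c wc; apply: wi;
      exists c.
  apply: wh; exists (\sum_i coord b i h * c i).
  rewrite {1}(bE h) (linear_for_sum wl) scaler_suml; apply: eq_bigr => i _.
  by rewrite (linear_forZ wl) wc scalerA.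
have [|G [v0 [Gpt sv0 v0n Gs Gv0]]] :=
  exists_pole divZ (s := [seq w k | k <- b]) (c := w b`_i0) _ wi0.
  by apply: map_f; rewrite memt_nth.
have {sv0} [h0 v0E] : exists h0, v0 = w h0.
  by case/mapP: sv0 => h0 _ ->; exists h0.
have /choice[c Gc] : forall i : 'I_(\dim {:H}), exists c, G (w b`_i / v0) c.
  by move=> i; apply: Gs; apply: map_f; rewrite memt_nth.
(* The specialisation of w / v0: values are chosen on a basis of H and extended linearly. *)
pose yf k : F^o := \sum_i coord b i k * c i.
have yfl : linear yf.
  move=> e u v; rewrite /yf scaler_sumr -big_split; apply: eq_bigr => i _.
  by rewrite linearP /= mulrDl -mulrA.
pose y : hopf_dual H := linfun yf.
have Gy k : G (w k / v0) (dual_app y k).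
  rewrite /dual_app linfunE // {1}(bE k) (linear_for_sum wl) mulr_suml.
  apply: (point_sum Gpt) => i _.
  by rewrite (linear_forZ wl) -scalerAl; apply: (point_scale Gpt).
(* The functionals that are specialisations of orbit maps; they form a commutative
   translation-stable subalgebra of the dual. *)
pose Q (x : hopf_dual H) :=
  exists s, forall k, G (orbit_map s k) (dual_app x k).
have Qshift g x : Q x -> Q (dual_shift g x).
  case=> s Gs'; exists [seq (p.1, act g p.2) | p <- s] => k.
  rewrite dual_shiftE (_ : orbit_map _ k = orbit_map s (k * g)) //.
  by rewrite /orbit_map big_map; apply: eq_bigr => p _; rewrite (act_comp actZ).
have QM x x' : Q x -> Q x' -> Q (x * x').
  case=> s Gx [s' Gx']; exists (orbit_mul s s') => k.
  rewrite orbit_mapM dual_mulE; apply: (point_tlift Gpt) => u v.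
  exact: (point_mul Gpt).
have Ql e x x' : Q x -> Q x' -> Q (e *: x + x').
  case=> s Gx [s' Gx']; exists ([seq (e *: p.1, p.2) | p <- s] ++ s') => k.
  rewrite dual_app_is_linear /orbit_map big_cat big_map.
  apply: (point_add Gpt); last exact: Gx'.
  rewrite (_ : \sum_(p <- s) _ = e *: orbit_map s k);
    first exact: (point_scale Gpt).
  by rewrite /orbit_map scaler_sumr; apply: eq_bigr => p _; rewrite scalerAl.
have Q0 : Q 0.
  exists [::] => k; rewrite /orbit_map big_nil /dual_app zero_lfunE.
  exact: (point0 Gpt).
have Q1 : Q 1.
  exists [:: (1, 1)] => k; rewrite /orbit_map big_seq1 mul1r (act_one actZ).
  rewrite dual_app1; exact: (point_scalar Gpt).
have Qy : Q y.
  exists [seq (a i / v0, a' i) | i <- index_enum 'I_n] => k.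
  rewrite (_ : orbit_map _ k = w k / v0) // /orbit_map big_map mulr_suml.
  by apply: eq_bigr => i _; rewrite mulrAC.
have QC x x' : Q x -> Q x' -> x * x' = x' * x.
  case=> s Gx [s' Gx']; apply: dual_appP => k.
  apply: (point_inj Gpt (x := orbit_map (orbit_mul s s') k));
    last rewrite orbit_mapC;
    rewrite orbit_mapM dual_mulE; apply: (point_tlift Gpt) => u v;
    exact: (point_mul Gpt).
have [UQ UQE] := ex_vspace Q0 Ql.
have shl : linear (fun g => dual_shift g y) :=
  act_linearl (dual_shift_module_algebra H) y.
(* [Y] is the space of translates of [y], and [(Y * UQ)%VS] is the ideal they generate in the
   subalgebra [UQ]. *)
pose Y : {vspace hopf_dual H} := limg (linfun (fun g => dual_shift g y)).
have YE x : x \in Y -> exists g, x = dual_shift g y.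
  by case/memv_imgP => g _ ->; exists g; rewrite linfunE.
have Yg g : dual_shift g y \in Y.
  by apply/memv_imgP; exists g; rewrite ?memvf ?linfunE.
have YQ x : x \in Y -> Q x by case/YE => g ->; apply: Qshift.
have NQ : (Y * UQ <= UQ)%VS.
  by apply/prodvP => x x' /YQ Qx /UQE Qx'; apply/UQE/QM.
have QN x : x \in (Y * UQ)%VS -> Q x by move=> Nx; apply/UQE/(subvP NQ).
have : dual_app (dual_shift h0 y * 1) 1 = 0.
  apply: (shift_stable_eval0 tI (N := (Y * UQ)%VS)).
  - by move=> x x' /QN Qx /QN Qx'; apply: QC.
  - rewrite -prodvA; apply: prodvSr; apply/prodvP => x x' /UQE Qx /QN Qx'.
    exact/UQE/QM.
  - move=> g; suff : (Y * UQ <= linfun (dual_shift g) @^-1: (Y * UQ))%VS.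
      move=> s x /(subvP s); rewrite -memv_preim linfunE //.
      exact: (act_linearr (dual_shift_module_algebra H)).
    apply/prodvP => x x' Yx UQx'; rewrite -memv_preim linfunE; last first.
      exact: (act_linearr (dual_shift_module_algebra H)).
    rewrite (act_mul (dual_shift_module_algebra H)); apply: memv_tlift => u v.
    apply: memv_mul; last by apply/UQE/Qshift/UQE.
    by have [g' ->] := YE x Yx;
      rewrite -(act_comp (dual_shift_module_algebra H)).
  - suff : (Y * UQ <= lker (linfun ((fun x => dual_app x t) : hopf_dual H ->
      F^o)))%VS.
      move=> s x /(subvP s); rewrite memv_ker linfunE; first exact/eqP.
      exact: dual_app_is_linear.
    apply/prodvP => x x' /YE[g ->] /UQE[s Gx']; rewrite memv_ker linfunE;
      last first.
      exact: dual_app_is_linear.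
    (* The value at [t] is computed twice: as a specialisation of v0^-1 times an orbit map it is 0,
       and by [casimir_shift_orbit] it is the value of the product. *)
    apply/eqP; apply: (point_inj Gpt (x := v0^-1 * orbit_map s (antipode g)));
      last first.
      rewrite -(mul0r (dual_app x' (antipode g))); exact: (point_mul Gpt).
    rewrite -casimir_shift_orbit (tlift_comp (f := fun z => v0^-1 * z));
      last first.
      by move=> e u v; rewrite mulrDr scalerAr.
    rewrite dual_mulE; apply: (point_tlift Gpt) => u v.
    rewrite dual_shiftE mulrA [v0^-1 * _]mulrC; exact: (point_mul Gpt).
  - by apply: memv_mul; [apply: Yg | apply/UQE].
rewrite mulr1 dual_shiftE mul1r => y0.
have := Gy h0;
  rewrite y0 -v0E divrr ?divZ // => /(point_inj Gpt (point1 Gpt))/eqP.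
by rewrite oner_eq0.
Qed.

End CasimirScalar.

(** * Actions on fields factor through cocommutative quotients *)

Section CommutativeActions.

Variables (F : closedFieldType) (H : hopfAlgType F) (Z : comUnitAlgType F).
Variable act : H -> Z -> Z.
Hypotheses (divZ : division_ring Z) (actZ : module_algebra act).

Let actl := act_linearl actZ.
Let actr := act_linearr actZ.

Lemma scalar_inj : injective (fun c : F => c%:A : Z).
Proof.
move=> c c' /eqP; rewrite -subr_eq0 -scalerBl scaler_eq0 oner_eq0 orbF subr_eq0.
by move/eqP.
Qed.

Theorem commutative_factors : semisimple H -> factors_cocommutative act.
Proof.
case/semisimple_integral => t tI.
have [n [a [a' dual_a]]] := integral_form_dual_bases divZ actZ tI.
pose w := casimir act a a'.
have wl : linear w := casimir_linear actZ a a'.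
have /choice[w0 w0E] : forall h, exists c, w h = c%:A.
  exact: casimir_scalar divZ actZ tI _ _ _ dual_a.
have w0l : linear (w0 : H -> F^o).
  move=> c u v; apply: scalar_inj.
  by rewrite -w0E wl !w0E scalerDl scalerA.
have [I IE] : exists I :
  {vspace H}, forall h, h \in I <-> forall z, act h z = 0.
  apply: ex_vspace => [z|c u v u0 v0 z]; first exact: (linear_for0 (actl z)).
  by rewrite actl u0 v0 scaler0 addr0.
(* By [casimir_act], [q h] acts as [h] does, but it depends on [h] only through the scalars
   [w0 (h * u)]. *)
pose q h := tlift (fun u v => w0 (h * u) *: antipode v) (comul t).
have Iq h : h - q h \in I.
  apply/IE => z;
    rewrite (linear_forB (actl z)) (casimir_act divZ actZ tI dual_a).
  rewrite (tlift_comp (f := fun k => act k z)) //.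
  apply/eqP; rewrite subr_eq0; apply/eqP/eq_tlift => u v.
  by rewrite (linear_forZ (actl z)) -/w w0E mulr_algl.
have [bl br] := ptens_bilinear H H.
have q0 s :
    (forall g g', tlift (fun u v => w0 (u * g) * w0 (v * g') : F^o) s = 0) ->
    tlift (fun u v => q u ⊗ q v) s = 0.
  move=> s0.
  transitivity (tlift (fun c d => tlift (fun c' d' =>
      tlift (fun u v => w0 (u * c) * w0 (v * c') : F^o) s
        *: (antipode d ⊗ antipode d'))
      (comul t)) (comul t)); last first.
    by apply: tlift_eq0 => c d; apply: tlift_eq0 => c' d'; rewrite s0 scale0r.
  transitivity (tlift (fun u v => tlift (fun c d => tlift (fun c' d' =>
      (w0 (u * c) * w0 (v * c')) *: (antipode d ⊗ antipode d'))
      (comul t)) (comul t)) s).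
    apply: eq_tlift => u v; rewrite /q.
    rewrite (tlift_comp (f := fun x => x ⊗ _)); last exact: bl.
    apply: eq_tlift => c d.
    rewrite (tlift_comp (f := fun x => _ ⊗ x)); last exact: br.
    apply: eq_tlift => c' d'.
    by rewrite (linear_forZ (bl _)) (linear_forZ (br _)) scalerA.
  rewrite exchange_tlift; apply: eq_tlift => c d.
  rewrite exchange_tlift; apply: eq_tlift => c' d'.
  rewrite -(tlift_comp (f :=
    fun x : F^o => (x : F) *: (antipode d ⊗ antipode d'))) //.
  by move=> e x y; rewrite scalerDl scalerA.
(* Decompose u ⊗ v as (u - q u) ⊗ v + q u ⊗ (v - q v) + q u ⊗ q v. The first two terms lie in the
   required sum, and the last one contributes 0 by [q0]. *)
have tensI s :
    (forall g g', tlift (fun u v => w0 (u * g) * w0 (v * g') : F^o) s = 0) ->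
    s \in (tensv I fullv + tensv fullv I)%VS.
  move=> /q0 s0; rewrite [s]tensE.
  have -> : tlift (@ptens F H H) s = tlift (fun u v => (u - q u) ⊗ v) s
      + tlift (fun u v => q u ⊗ (v - q v)) s.
    rewrite tliftD -[RHS]addr0 -s0 tliftD; apply: eq_tlift => u v.
    by rewrite (linear_forB (bl v)) (linear_forB (br (q u))) addrA subrK subrK.
  apply: memv_add; apply: memv_tlift => u v; apply: memv_tens;
    rewrite ?memvf //.
have orbit_w g u :
  w (u * g) = orbit_map act [seq (a i, act g (a' i)) | i <- index_enum 'I_n] u.
  rewrite /orbit_map big_map; apply: eq_bigr => i _.
  by rewrite (act_comp actZ).
have w0w0 g g' h :
    (tlift (fun u v => w0 (u * g) * w0 (v * g') : F^o) (comul h) : F)%:A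
    = tlift (fun u v => w (u * g) * w (v * g')) (comul h).
  rewrite (tlift_comp (f := fun x : F^o => (x : F)%:A : Z)); last first.
    by move=> e x y; rewrite scalerDl scalerA.
  by apply: eq_tlift => u v; rewrite !w0E mulr_algl scalerA.
have w0b g g' : bilinear_map (fun u v => w0 (u * g) * w0 (v * g') : F^o).
  have wm k : linear (fun u => w0 (u * k) : F^o).
    by move=> c u v; rewrite mulrDl -scalerAl w0l.
  exact: (bilinear_comp (mul_bilinear F^o) (wm g) (wm g')).
have Il : (fullv * I <= I)%VS.
  apply/prodvP => g h _ /IE Ih; apply/IE => z.
  by rewrite (act_comp actZ) Ih (linear_for0 (actr g)).
have Ir : (I * fullv <= I)%VS.
  by apply/prodvP => h g /IE Ih _; apply/IE => z; rewrite (act_comp actZ) Ih.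
have Icomul h : h \in I -> comul h \in (tensv I fullv + tensv fullv I)%VS.
  (* A convolution product of two translates of [w] is an orbit map, and every orbit map vanishes on
     the annihilator. *)
  move/IE=> Ih; apply: tensI => g g'; apply: scalar_inj; rewrite w0w0 scale0r.
  under eq_tlift => u v do rewrite !orbit_w.
  rewrite -(orbit_mapM actZ) /orbit_map big1 // => p _.
  by rewrite Ih mulr0.
have Icounit h : h \in I -> counit h = 0.
  by move/IE/(_ 1); rewrite (act_one actZ) => /eqP;
    rewrite scaler_eq0 oner_eq0 orbF => /eqP.
have Iantipode h : h \in I -> antipode h \in I.
  move/IE=> Ih; apply/IE => z; apply: (integral_form_nondeg divZ actZ tI) => x.
  by rewrite -(integral_form_adj actZ tI) Ih mul0r (linear_for0 (actr t)).
exists (HopfIdeal Il Ir Icomul Icounit Iantipode).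
set J := HopfIdeal _ _ _ _ _.
split=> [h z /IE|x]; first exact.
rewrite -(quot_reprK x) -[comul _]/(quot_comul _) quot_comulE;
  set h := quot_repr x.
have bpp : bilinear_map (fun a b => quot_pi J a ⊗ quot_pi J b).
  exact: (bilinear_comp (ptens_bilinear _ _) (quot_pi_is_linear J)
    (quot_pi_is_linear J)).
transitivity (tmap (quot_pi J) (quot_pi J) (tswap (comul h))).
  rewrite /tmap tlift_tswap // /tswap (linear_tlift (tlift _)).
  by apply: eq_tlift => u v /=; rewrite tlift_ptens //;
    apply/bilinear_swap/ptens_bilinear.
apply/eqP; rewrite -subr_eq0 /tmap -linearB; apply/eqP.
(* Swapping the coproduct exchanges two translates of [w], which commute, so the difference passes
   the test [tensI]. *)
apply: (tmap_pi_eq0 (I := J)); apply: tensI => g g'; rewrite linearB /=.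
rewrite tlift_tswap //; apply/eqP; rewrite subr_eq0; apply/eqP/scalar_inj.
rewrite [in LHS](@eq_tlift F H H F^o _ (fun u v => w0 (u * g') * w0 (v * g))).
  rewrite !w0w0; under [LHS]eq_tlift => u v do rewrite !orbit_w.
  under [RHS]eq_tlift => u v do rewrite !orbit_w.
  by rewrite -!(orbit_mapM actZ) orbit_mapC.
by move=> u v; rewrite mulrC.
Qed.

End CommutativeActions.

(** * Linear algebra over division subrings *)

Section DivisionSubrings.

Variable D : unitRingType.
Hypothesis divD : division_ring D.

Definition division_subring (S : D -> Prop) : Prop :=
  [/\ S 1, forall x y, S x -> S y -> S (x - y),
      forall x y, S x -> S y -> S (x * y) & forall x, S x -> S x^-1].

Definition independent_over (S : D -> Prop) (I : finType) (f : I -> D) : Prop :=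
  forall c, (forall i, S (c i)) -> \sum_i c i * f i = 0 -> forall i, c i = 0.

Definition spanned_over (S : D -> Prop) (I : finType) (f : I ->
  D) (x : D) : Prop :=
  exists2 c, forall i, S (c i) & x = \sum_i c i * f i.

Definition adjoin (n : nat) (f : 'I_n -> D) (x : D) (j : 'I_n.+1) : D :=
  oapp f x (unlift ord0 j).

Section OneSubring.

Variables (S : D -> Prop) (divS : division_subring S).

Lemma subring0 : S 0.
Proof. by case: divS => S1 SB _ _; rewrite -(subrr 1); apply: SB. Qed.

Lemma subringN x : S x -> S (- x).
Proof.
by case: divS => _ SB _ _ Sx; rewrite -sub0r; apply: SB => //; apply: subring0.
Qed.

Lemma subringD x y : S x -> S y -> S (x + y).
Proof.
by case: divS => _ SB _ _ Sx Sy; rewrite -[y]opprK; apply: SB => //;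
  apply: subringN.
Qed.

Lemma subring_sum (I : Type) (r : seq I) (P : pred I) (f : I -> D) :
  (forall i, P i -> S (f i)) -> S (\sum_(i <- r | P i) f i).
Proof. by move=> Sf; elim/big_ind: _ => //;
  [apply: subring0 | apply: subringD]. Qed.

(** Gaussian elimination. The support condition on [A] lets the pivot be removed while the index
    type stays fixed. *)
Lemma linear_relation (I : finType) (A : {set I}) n (v : I -> 'I_n -> D) :
  (forall j i, S (v j i)) -> (n < #|A|)%N ->
  exists c : I -> D, [/\ forall j, S (c j), forall j, j \notin A -> c j = 0,
    exists j, c j != 0 & forall i, \sum_j c j * v j i = 0].
Proof.
have [S1 SB SM SV] := divS.
elim: n A v => [|n IHn] A v Sv ltnA.
  have [j0 Aj0] : exists j, j \in A by apply/card_gt0P.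
  exists (fun j => if j == j0 then 1 else 0); split=> [j|j|| []//].
  - by case: ifP => _ //; apply: subring0.
  - by apply: contraNeq; case: (j =P j0) => [->|]; rewrite ?eqxx.
  - by exists j0; rewrite eqxx oner_eq0.
have [[j0 [Aj0 vj0]]|v0] := pselect (exists j, j \in A /\ v j ord0 != 0);
  last first.
  have [|c [Sc cA cn0 c0]] :=
    IHn A (fun j i => v j (lift ord0 i)) _ (ltnW ltnA) => [//|].
  exists c; split=> // i; case: (unliftP ord0 i) => [i' ->|->]; first exact: c0.
  rewrite big1 // => j _; have [Aj|/cA->] := boolP (j \in A);
    last by rewrite mul0r.
  have -> : v j ord0 = 0; last by rewrite mulr0.
  by apply: contrapT => /eqP vj; apply: v0; exists j.
pose r j := v j ord0 / v j0 ord0.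
have Sr j : S (r j) by apply: (SM _ _ (Sv _ _)); apply: SV.
have [||c [Sc cA [j1 cj1] c0]] :=
  IHn (A :\ j0) (fun j i => v j (lift ord0 i) - r j * v j0 (lift ord0 i)).
- by move=> j i; apply: SB => //; apply: SM.
- by rewrite (cardsD1 j0) Aj0 in ltnA.
have cj0 : c j0 = 0 by apply: cA; rewrite !inE eqxx.
(* The pivot's coefficient undoes the subtracted multiples of its vector and so also cancels the
   first coordinate. *)
exists (fun j => if j == j0 then - \sum_j c j * r j else c j); split.
- move=> j; case: ifP => // _; apply/subringN/subring_sum => i _; exact: SM.
- move=> j jA; rewrite ifN; first by apply: cA; rewrite !inE negb_and jA orbT.
  by apply: contraNneq jA => ->.
- exists j1; rewrite ifN //; apply: contraNneq cj1 => ->; exact/eqP.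
move=> i; rewrite (bigD1 j0) //= eqxx.
rewrite [X in _ + X](eq_bigr (fun j => c j * v j i)) => [|j /negPf-> //].
have -> : \sum_(j | j != j0) c j * v j i = \sum_j c j * v j i.
  by rewrite [RHS](bigD1 j0) //= cj0 mul0r add0r.
rewrite mulNr mulr_suml addrC -sumrB.
case: (unliftP ord0 i) => [i' ->|->].
    rewrite -[RHS](c0 i'); apply: eq_bigr => j _.
  by rewrite mulrBr [in RHS]mulrA.
by rewrite big1 // => j _; rewrite -mulrA divrK ?subrr // divD.
Qed.

Lemma independent_leq_card (I J : finType) (g : I -> D) (e : J -> D) :
  independent_over S g -> (forall i, spanned_over S e (g i)) ->
    (#|I| <= #|J|)%N.
Proof.
move=> gfree ge; rewrite leqNgt; apply/negP => ltJI.
have /choice[A AP] : forall i, exists A : J -> D,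
    (forall j, S (A j)) /\ g i = \sum_j A j * e j.
  by move=> i; have [A SA gi] := ge i; exists A.
have [|c [Sc _ [i ci] c0]] := @linear_relation I setT #|J|
    (fun i k => A i (enum_val k)) (fun i k => (AP i).1 _);
      first by rewrite cardsT.
case/negP: ci; apply/eqP/(gfree c) => //.
under eq_bigr => k _ do rewrite (AP k).2 mulr_sumr.
rewrite exchange_big big1 //= => j _.
under eq_bigr => k _ do rewrite mulrA.
rewrite -mulr_suml -(enum_rankK j).
by have := c0 (enum_rank j) => ->; rewrite mul0r.
Qed.

Lemma independent_adjoin n (f : 'I_n -> D) x :
  independent_over S f -> ~ spanned_over S f x ->
  independent_over S (adjoin f x).
Proof.
have [S1 SB SM SV] := divS; move=> ffree fx c Sc.
rewrite big_ord_recl /adjoin unlift_none /=.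
under eq_bigr => i _ do rewrite liftK /=.
have [c0|c0] := eqVneq (c ord0) 0.
  rewrite c0 mul0r add0r => cf0 i; case: (unliftP ord0 i) => [j ->|->//].
  exact: (ffree (fun j => c (lift ord0 j))).
move=> cf0; case: fx; exists (fun j => - ((c ord0)^-1 * c (lift ord0 j))).
  by move=> j; apply/subringN/SM => //; apply: SV.
under eq_bigr => j _ do rewrite mulNr -mulrA.
rewrite sumrN -mulr_sumr; apply: (mulrI (divD c0)).
by rewrite mulrN mulVKr ?divD //; apply/eqP; rewrite -addr_eq0 cf0.
Qed.

Lemma exists_basis (M : D -> Prop) b :
  (forall n (f : 'I_n -> D), (forall i, M (f i)) -> independent_over S f ->
    (n <= b)%N) ->
  exists n (f : 'I_n -> D), [/\ forall i, M (f i), independent_over S f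
    & forall x, M x -> spanned_over S f x].
Proof.
move=> bound; apply: contrapT => no.
suff ext n : exists f : 'I_n -> D, (forall i, M (f i)) /\ independent_over S f.
  by have [f [Mf ffree]] := ext b.+1; have := bound _ f Mf ffree; rewrite ltnn.
elim: n => [|n [f [Mf ffree]]]; first by exists (fun=> 0); split=> [|c _ _] [].
have [x [Mx fx]] : exists x, M x /\ ~ spanned_over S f x.
  apply: contrapT => nox; apply: no; exists n, f; split=> // x Mx.
  by apply: contrapT => fx; apply: nox; exists x.
exists (adjoin f x); split; last exact: independent_adjoin.
by move=> i; rewrite /adjoin; case: unliftP => [j|] _ /=.
Qed.

End OneSubring.

Lemma central_division_subring : division_subring (@central D).
Proof.
split=> [x|x y zx zy u|x y zx zy u|x zx u].
- by rewrite mul1r mulr1.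
- by rewrite mulrBl mulrBr zx zy.
- by rewrite -mulrA zy !mulrA zx.
have [xU|xnU] := boolP (x \is a GRing.unit); last by rewrite invr_out.
by apply: (mulrI xU); rewrite mulVKr // mulrA zx mulrK.
Qed.

End DivisionSubrings.

(** * Artin's independence argument *)

Section Artin.

Variables (F : fieldType) (H : hopfAlgType F) (D : unitAlgType F).
Variable act : H -> D -> D.
Hypotheses (divD : division_ring D) (actD : module_algebra act).

Let actl := act_linearl actD.
Let actr := act_linearr actD.

(* Artin's lemma: a shortest relation \sum c_j (h . x_j) = 0 valid for all h,
   normalised to have a coefficient 1, has invariant coefficients. *)
Lemma independent_invariants_leq n (x : 'I_n -> D) :
  independent_over (invariant_elt act) x -> (n <= \dim {:H})%N.
Proof.
move=> xfree; rewrite leqNgt; apply/negP => ltdn.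
pose K (c : 'I_n -> D) := forall h, \sum_j c j * act h (x j) = 0.
have K0 k c : K c -> (#|[set j | c j != 0%R]| < k)%N -> forall j, c j = 0.
  elim: k c => // k IHk c Kc szc j0; apply: contrapT => /eqP cj0.
  pose c' j := (c j0)^-1 * c j.
  have c'j0 : c' j0 = 1 by rewrite /c' mulVr // divD.
  have Kc' h : \sum_j c' j * act h (x j) = 0.
    by under eq_bigr => j _ do rewrite -mulrA; rewrite -mulr_sumr Kc mulr0.
  (* For each [g], the family g . c'_j - counit(g) c'_j is again a relation, by
     [module_algebra_mulC]. It vanishes at [j0], where c' is 1, so its support is smaller and the
     induction makes it zero. *)
  have inv j : invariant_elt act (c' j).
    move=> g; apply/eqP; rewrite -subr_eq0; apply/eqP; move: j.
    apply: IHk => [h|].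
      under eq_bigr => j _ do rewrite mulrBl -scalerAl.
      rewrite sumrB -scaler_sumr Kc' scaler0 subr0.
      under eq_bigr => j _ do rewrite (module_algebra_mulC actD).
      rewrite tlift_sum; apply: tlift_eq0 => a b.
      under eq_bigr => j _ do rewrite -(act_comp actD).
      by rewrite -(linear_for_sum (actr a)) Kc' (linear_for0 (actr a)).
    rewrite -ltnS; apply: leq_trans szc; rewrite ltnS; apply: proper_card.
    apply/properP; split.
      apply/subsetP => j; rewrite !inE; apply: contraNneq => cj.
      by rewrite /c' cj mulr0 (linear_for0 (actr g)) scaler0 subr0.
    exists j0; rewrite !inE ?cj0 // c'j0 (act_one actD) subrr eqxx //.
  have := xfree c' inv; rewrite (_ : \sum_i _ = 0).
    by move=> /(_ erefl j0)/eqP; rewrite c'j0 oner_eq0.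
  by rewrite -[RHS](Kc' 1); apply: eq_bigr => j _; rewrite (act_id actD).
(* The values on a basis of H give more than [\dim {:H}] vectors of that length over D, hence a
   relation. *)
have [|||c [_ _ [j cj] c0]] := @linear_relation D divD (fun=> True) _ 'I_n setT
    (\dim {:H}) (fun j i => act (vbasis {:H})`_i (x j)) => //.
  by rewrite cardsT card_ord.
case/negP: cj; apply/eqP/(K0 _ c _ (leqnn _)) => h.
rewrite (coord_vbasis (memvf h)).
under eq_bigr => i _ do rewrite (linear_for_sum (actl (x i))) mulr_sumr.
rewrite exchange_big big1 //= => i _.
under eq_bigr => k _ do rewrite (linear_forZ (actl (x k))) -scalerAr.
by rewrite -scaler_sumr c0 scaler0.
Qed.

End Artin.

(** * The center and the invariants generate D *)

Section InvariantsGenerate.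

Variables (F : fieldType) (H : hopfAlgType F) (D : unitAlgType F) (m : nat).
Variable act : H -> D -> D.
Hypotheses (degD : division_algebra_of_degree D m) (actD : module_algebra act).
Hypothesis co_dm : coprime (\dim {:H})`! m.

Let divD : division_ring D := degD.1.
Let E := center_invariants act.

Lemma center_invariants_central z : central z -> E z.
Proof. by move=> zz S _ Sz _; apply: Sz. Qed.

Lemma center_invariants_invariant x : invariant_elt act x -> E x.
Proof. by move=> ix S _ _ Si; apply: Si. Qed.

Lemma center_invariantsM x y : E x -> E y -> E (x * y).
Proof. by move=> Ex Ey S Salg Sz Si; case: (Salg) => _ _; apply;
  [apply: Ex | apply: Ey]. Qed.

Lemma center_invariantsB x y : E x -> E y -> E (x - y).
Proof.
move=> Ex Ey S Salg Sz Si; case: (Salg) => _ Sl _.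
by rewrite addrC -scaleN1r; apply: Sl; [apply: Ey | apply: Ex].
Qed.

Lemma center_invariants_basis : exists n (f : 'I_n -> D),
  [/\ forall i, E (f i), independent_over (@central D) f
    & forall x, E x -> spanned_over (@central D) f x].
Proof.
have zD := central_division_subring D.
have [_ [e [espan _]]] := degD.
apply: (exists_basis divD zD (b := m ^ 2)) => n f _ ffree.
have := independent_leq_card divD zD ffree (e := e); rewrite !card_ord; apply.
by move=> i; have [z zz ->] := espan (f i); exists z.
Qed.

(** [E] has a finite basis [f] over the center. If 1 were outside the span of the products
    [x * f i], adjoining it would give too many independent elements of [E]; so 1 is [x] times an
    element of [E]. *)
Lemma center_invariants_division_subring : division_subring E.
Proof.
have zD := central_division_subring D.
split; [| exact: center_invariantsB | exact: center_invariantsM |].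
  by apply: center_invariants_central => x; rewrite mul1r mulr1.
move=> x Ex; have [xU|xnU] := boolP (x \is a GRing.unit);
  last by rewrite invr_out.
have [n [f [Ef ffree fspan]]] := center_invariants_basis.
have [c zc c1] : spanned_over (@central D) (fun i => x * f i) 1.
  apply: contrapT => no1.
  have xfree : independent_over (@central D) (fun i => x * f i).
    move=> c zc c0; apply: ffree => //; apply: (mulrI xU);
      rewrite mulr0 mulr_sumr -[RHS]c0.
    by apply: eq_bigr => i _; rewrite [LHS]mulrA -zc mulrA.
  have := independent_leq_card divD zD (independent_adjoin divD zD xfree no1)
    (e := f).
  rewrite !card_ord ltnn => /(_ _)/notF; apply => i; apply: fspan.
  rewrite /adjoin; case: unliftP => [j|] _ /=; first exact: center_invariantsM.
  by apply: center_invariants_central => y; rewrite mul1r mulr1.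
have -> : x^-1 = \sum_i c i * f i.
  apply: (mulrI xU); rewrite mulrV // [LHS]c1 mulr_sumr.
  by apply: eq_bigr => i _; rewrite [RHS]mulrA -zc mulrA.
have E0 : E 0 by apply: center_invariants_central => y; rewrite mul0r mulr0.
elim/big_ind: _ => // [y z Ey Ez|i _].
  rewrite -[z]opprK; apply: center_invariantsB => //.
  by rewrite -sub0r; apply: center_invariantsB.
by apply: center_invariantsM => //; apply: center_invariants_central.
Qed.

Theorem center_invariants_full x : E x.
Proof.
have zD := central_division_subring D.
have ED := center_invariants_division_subring.
have [l [f [Ef ffree fspan]]] := center_invariants_basis.
have bound n (y : 'I_n -> D) : independent_over E y -> (n <= \dim {:H})%N.
  move=> yfree;
    apply: (independent_invariants_leq divD actD (x := y)) => c ic c0.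
  by apply: yfree => // i; apply: center_invariants_invariant.
have [k [y [_ yfree yspan]]] :=
  exists_basis divD ED (M := fun=> True) (fun n y _ => bound n y).
have k_le := bound k y yfree.
(* The product basis of the tower Z, E, D, which yields l k = m^2. *)
pose fy (p : 'I_l * 'I_k) := f p.1 * y p.2.
have fyfree : independent_over (@central D) fy.
  move=> c zc c0 [i j].
  have fc0 : \sum_i c (i, j) * f i = 0.
    apply: (yfree (fun j => \sum_i c (i, j) * f i)).
      move=> j'; apply: (subring_sum ED) => i' _;
        apply: center_invariantsM => //.
      exact: center_invariants_central.
    transitivity (\sum_i \sum_j c (i, j) * fy (i, j)); last first.
      by rewrite pair_bigA -[RHS]c0; apply: eq_bigr => -[].
    rewrite exchange_big; apply: eq_bigr => j' _; rewrite mulr_suml.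
    by apply: eq_bigr => i' _; rewrite mulrA.
  exact: (ffree (fun i => c (i, j))).
have fyspan z : spanned_over (@central D) fy z.
  have [c Ec ->] := yspan z I.
  have /choice[c' c'P] : forall j, exists c' : 'I_l -> D,
      (forall i, central (c' i)) /\ c j = \sum_i c' i * f i.
    by move=> j; have [c' zc' cE] := fspan _ (Ec j); exists c'.
  exists (fun p => c' p.2 p.1); first by move=> p; apply: (c'P p.2).1.
  transitivity (\sum_i \sum_j c' j i * fy (i, j)); last first.
    by rewrite pair_bigA; apply: eq_bigr => -[].
  rewrite exchange_big; apply: eq_bigr => j _; rewrite (c'P j).2 mulr_suml.
  by apply: eq_bigr => i _; rewrite mulrA.
have [_ [e [espan efree]]] := degD.
have lk : (l * k = m ^ 2)%N.
  apply/eqP; rewrite eqn_leq; apply/andP; split.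
    have := independent_leq_card divD zD fyfree (e := e).
    rewrite card_prod !card_ord; apply => p.
    by have [z zz ->] := espan (fy p); exists z.
  have := independent_leq_card divD zD (g := e) (e := fy).
  by rewrite card_prod !card_ord; apply.
have k_gt0 : (0 < k)%N.
  rewrite lt0n; apply/eqP => k0; have [c _ /eqP] := yspan 1 I.
  by rewrite big1 ?oner_eq0 // => j; have := ltn_ord j; rewrite {2}k0.
have k1 : k = 1%N.
  apply/eqP; rewrite -dvdn1 -(eqP (_ : coprime (\dim {:H})`! (m ^ 2))).
    by rewrite dvdn_gcd dvdn_fact ?k_gt0 // -lk dvdn_mull.
  exact: coprimeXr.
move: yspan yfree {k_le fy fyfree fyspan lk k_gt0};
  rewrite k1 in y * => yspan _.
(* Now D = E y_0 with a single generator; as 1 = c y_0, the generator is the inverse of an element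
   of [E]. *)
have [c Ec] := yspan 1 I; rewrite big_ord1 => c1.
have y0U : y ord0 \is a GRing.unit.
  by apply: divD; apply/eqP => y0; move/eqP: c1; rewrite y0 mulr0 oner_eq0.
have Ey : E (y ord0).
  have -> : y ord0 = (c ord0)^-1; last by case: ED => _ _ _; apply.
  by rewrite -[LHS]invrK; congr _^-1; apply: (mulIr y0U); rewrite mulVr.
have [c' Ec' ->] := yspan x I; rewrite big_ord1.
exact: center_invariantsM.
Qed.

(** The centralizer of h . z is a subalgebra, so only generators of [E] need testing; for an
    invariant [c], (h . z) c = h . (z c) = h . (c z) = c (h . z). *)
Theorem center_stable h z : central z -> central (act h z).
Proof.
move=> zz x;
  apply: (@center_invariants_full x (fun x => act h z * x = x * act h z));
    first split.
- by rewrite mulr1 mul1r.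
- by move=> a u v uz vz; rewrite mulrDr mulrDl -scalerAl -scalerAr uz vz.
- by move=> u v uz vz; rewrite mulrA uz -!mulrA vz.
- by move=> u uz; rewrite uz.
- move=> c ic.
  by rewrite -(invariant_mulr _ _ actD ic) zz (invariant_mull _ _ actD ic).
Qed.

End InvariantsGenerate.

(** * The center as a field with an action of H *)

Section Center.

Variables (F : fieldType) (D : unitAlgType F).

(** Centrality as a classical boolean predicate, the form in which the center can become a subtype
    with inherited algebra structure. *)
Definition centralb : {pred D} := fun x => `[< central x >].

Lemma centralbP x : reflect (central x) (x \in centralb).
Proof. exact: asboolP. Qed.

Lemma centralb_divalg_closed : divalg_closed centralb.
Proof.
have [z1 zB zM zV] := central_division_subring D.
split; first exact/centralbP.
  move=> a x y /centralbP zx /centralbP zy; apply/centralbP => u.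
  by rewrite mulrDl mulrDr -scalerAl -scalerAr zx zy.
by move=> x y /centralbP zx /centralbP zy; apply/centralbP/zM => //; apply: zV.
Qed.

HB.instance Definition _ :=
  GRing.isDivalgClosed.Build F D centralb centralb_divalg_closed.

Record center_of := Center { center_val :> D;
  center_valP : center_val \in centralb }.

HB.instance Definition _ := [isSub for center_val].
HB.instance Definition _ := [Choice of center_of by <:].
HB.instance Definition _ := [SubChoice_isSubUnitRing of center_of by <:].
HB.instance Definition _ := [SubZmodule_isSubLmodule of center_of by <:].
HB.instance Definition _ :=
  [SubNzRing_SubLmodule_isSubLalgebra of center_of by <:].
HB.instance Definition _ := [SubLalgebra_isSubAlgebra of center_of by <:].

Lemma center_mulC : commutative (@GRing.mul center_of).
Proof.
move=> x y; apply: val_inj; rewrite !rmorphM /=.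
exact: (centralbP _ (valP x)).
Qed.

HB.instance Definition _ :=
  GRing.PzRing_hasCommutativeMul.Build center_of center_mulC.

Lemma center_division : division_ring D -> division_ring center_of.
Proof.
move=> divD x xn; have xU : center_val x \is a GRing.unit.
  by apply: divD; apply: contraNneq xn => x0; apply/eqP/val_inj; rewrite /= x0.
have [_ _ _ zV] := central_division_subring D.
have xV : (center_val x)^-1 \in centralb.
  by apply/centralbP/zV/centralbP/center_valP.
apply/unitrP; exists (Center xV); split; apply: val_inj;
  by rewrite rmorphM rmorph1 /= ?mulVr ?mulrV.
Qed.

Variables (H : hopfAlgType F) (act : H -> D -> D).
Hypothesis actD : module_algebra act.
Hypothesis stable : forall h z, central z -> central (act h z).

Lemma center_act_subproof h (z : center_of) : act h z \in centralb.
Proof. by apply/centralbP/stable/centralbP/center_valP. Qed.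

Definition center_act h z : center_of := Center (center_act_subproof h z).

Lemma center_act_module_algebra : module_algebra center_act.
Proof.
split.
- by move=> x a g h; apply: val_inj; rewrite linearP /= (act_linearl actD).
- by move=> h a x y; apply: val_inj; rewrite !linearP /= (act_linearr actD).
- by move=> x; apply: val_inj; rewrite /= (act_id actD).
- by move=> g h x; apply: val_inj; rewrite /= (act_comp actD).
- move=> h x y; apply: val_inj.
  rewrite (linear_tlift (val : {linear center_of -> D})) /=.
  by rewrite (act_mul actD).
- by move=> h; apply: val_inj; rewrite linearZ /= (act_one actD).
Qed.

End Center.

Theorem proposition3p3 (F : closedFieldType) (H : hopfAlgType F) (d : nat)
    (dimH : \dim (fullv : {vspace H}) = d)
    (D : unitAlgType F) (m : nat) (degD : division_algebra_of_degree D m)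
    (act : H -> D -> D) (actD : module_algebra act)
    (co_dm : coprime d`! m) :
  ((forall (h : H) (z : D), central z -> central (act h z))
   /\ (forall x : D, center_invariants act x))
  /\ (semisimple H -> cosemisimple H -> factors_cocommutative act).
Proof.
rewrite -dimH in co_dm.
have stable := center_stable degD actD co_dm.
have full := center_invariants_full degD actD co_dm.
split=> // ssH _.
have [I [I0 cocomI]] := commutative_factors (center_division degD.1)
  (center_act_module_algebra actD stable) ssH.
(* The ideal kills the center, hence all of D: each element is a sum of products z a with z central
   and a invariant, and h . (z a) = (h . z) a. *)
exists I; split=> // h x Ih.
have /(center_invariantsP x actD)[s sP ->] := full x.
rewrite (linear_for_sum (act_linearr actD h)) big_seq big1 // => p /sP[zp ip].
rewrite (invariant_mulr _ _ actD ip).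
have zb : p.1 \in centralb (D := D) by apply/centralbP.
by have /(congr1 val) /= -> := I0 h (Center zb) Ih; rewrite mul0r.
Qed.
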